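(* Let $p\in(0,1/2)$ and $\delta\in(0,1)$. Let $\tilde\phi^N$ be the NSII mechanism and $\tilde\phi^B$ the BHW mechanism defined in the context, with taxes $\tilde f^{N,x}$ and $\tilde f^{B,x}$ (both given by the profit-maximizing tax $\tilde f^x$). Then: (1) NSII is an NT-FPM mechanism. (2) NSII improves expected individual welfares: for all $t\ge1$, $$\mathbb E^{\tilde\phi^N}\big[u_t(W,A_t)-\tilde f^{N,x}(\eta_t,\tilde\theta_t)\big]\ \ge\ \mathbb E^{\tilde\phi^B}\big[u_t(W,A_t)-\tilde f^{B,x}(\eta_t,\tilde\theta_t)\big].$$ (3) NSII strictly improves the expected net social welfare: $\mathbb E^{\tilde\phi^N}[\mathrm{NSW}]>\mathbb E^{\tilde\phi^B}[\mathrm{NSW}]$. (4) NSII brings the coordinator a positive expected revenue: $\mathbb E^{\tilde\phi^N}\big[\sum_{t=1}^\infty\tilde f^{N,x}(\eta_t,\tilde\theta_t)\big]>0$.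
   Context: Model. Let $\bar p=1-p$, $\mathcal W=\mathcal Y=\mathcal M=\mathcal A=\{-1,1\}$. $W$ is uniform on $\mathcal W$; given $W=w$, the private signals $Y_1,Y_2,\dots$ of agents $1,2,\dots$ are i.i.d. with $Q^y(y\mid w)=\bar p$ if $y=w$ and $p$ otherwise. Utility: $u_t(w,a_t)=1\{a_t=w\}$. $\Delta(S)$ is the set of probability distributions on $S$; $1_k$ is the point mass at $k$. For integer $n$: $q(1\mid n)=\frac{(\bar p/p)^n}{(\bar p/p)^n+1}$, $q(-1\mid n)=\frac1{(\bar p/p)^n+1}$. Summary-based mechanism. A map $\tilde\phi:\Delta(\mathbb Z)\to(\mathbb Z\times\mathcal M\to\Delta(\mathcal A))$. Under it all agents join and report truthfully ($M_t=Y_t$); the summary is $n_t=\sum_{\tau<t}M_\tau$ (known to the coordinator only); with $\tilde\theta_t=\tilde\phi[\eta_t]$ the recommended and taken action is $A_t\sim\tilde\theta_t(\cdot\mid n_t,M_t)$, which is public. The public belief $\eta_t\in\Delta(\mathbb Z)$ about $n_t$ starts at $\eta_1=1_0$ and updates by $\eta_{t+1}=\tilde T(\eta_t,a_t,\tilde\theta_t)$, where $$\tilde T(\eta,a,\tilde\theta)(n')=\frac{\sum_{w}\sum_{m\in\{-1,1\}}\eta(n'-m)\,q(w\mid n'-m)\,Q^y(m\mid w)\,\tilde\theta(a\mid n'-m,m)}{\sum_{w,n,m}\eta(n)\,q(w\mid n)\,Q^y(m\mid w)\,\tilde\theta(a\mid n,m)}.$$ $\mathbb E^{\tilde\phi}$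 is expectation under this process. Profit-maximizing tax: $\tilde f^x(\eta,\tilde\theta)=\sum_{y,w,n}Q^y(y\mid w)\eta(n)q(w\mid n)\big(\tilde\theta(w\mid n,y)-\gamma_\eta(w\mid y)\big)$, where $\gamma_\eta(\cdot\mid y)$ (the optimal action of a non-joining agent) is supported on the maximizers over $a$ of $Q^y(y\mid a)\sum_n\eta(n)q(a\mid n)$; the value does not depend on tie-breaking. With this tax an agent's expected net utility from joining equals that from not joining, so individual rationality (joining is no worse than not joining) holds. NT-FPM (nonnegative taxation, feasible, profit maximizing): a mechanism with the profit-maximizing tax above (hence individually rational) which is truth-telling, i.e. for every $\eta\in\Delta(\mathbb Z)$ the partial strategy $\tilde\theta=\tilde\phi[\eta]$ satisfies $\sum_{w,n}Q^y(y\mid w)\eta(n)q(w\mid n)\big(\tilde\theta(w\mid n,y)-\tilde\theta(w\mid n,-y)\big)\ge0$ for both $y$, and whose tax $\tilde f^x(\eta,\tilde\phi[\eta])$ is nonnegative for every $\eta$. Partial strategies. $\tilde\theta^L(\cdot\mid n,m)=1_m$; $\tilde\theta^{C+}(\cdot\mid n,m)=1_{+1}$; $\tilde\theta^{C-}(\cdot\mid n,m)=1_{-1}$; $\tilde\theta^N(\cdot\mid n,m)=1_{\mathrm{sign}(n+m)}$ if $n+m\ne0$ and $1_{\mathrm{sign}(n)}$ if $n+m=0$. Let $\ell(\eta)=\frac{\sum_n\eta(n)q(+1\mid n)}{\sum_n\eta(n)q(-1\mid n)}$ and $\mathcal L=\{\eta: p/\bar p\le\ell(\eta)\le\bar p/p\}$.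 BHW: $\tilde\phi^B[\eta]=\tilde\theta^L$ if $\eta\in\mathcal L$, $\tilde\theta^{C+}$ if $\ell(\eta)>\bar p/p$, $\tilde\theta^{C-}$ otherwise. NSII (''no switch if indifference''): $\tilde\phi^N[\eta]=\tilde\theta^L$ if $\eta\in\mathcal L$, $\tilde\theta^N$ otherwise. Net social welfare under a mechanism: $\mathrm{NSW}=\sum_{t=1}^\infty\delta^{t-1}\big(u_t(W,A_t)-\tilde f^x(\eta_t,\tilde\theta_t)\big)$. *)

(* Defs.v *)
From HB Require Import structures.
From mathcomp Require Import all_boot all_order all_algebra.
From mathcomp Require Import lra.
From mathcomp Require Import all_classical all_reals all_analysis.

Set Implicit Arguments.
Unset Strict Implicit.
Unset Printing Implicit Defensive.

Import Order.TTheory GRing.Theory Num.Theory.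
Import numFieldNormedType.Exports.

Local Open Scope classical_set_scope.
Local Open Scope ring_scope.

Section Distributions.
Context {R : realType}.

Definition is_pmf (S : choiceType) (f : S -> R) : Prop :=
  (forall s, 0 <= f s) /\ \esum_(s in [set: S]) (f s)%:E = 1%E.

Record distr (S : choiceType) := Distr {
  mass :> S -> R;
  massP : is_pmf mass
}.

Lemma mass_ge0 (S : choiceType) (d : distr S) (s : S) : 0 <= d s.
Proof. by have [] := massP d. Qed.

Lemma point_mass_subproof (S : choiceType) (k : S) :
  is_pmf (fun s => (s == k)%:R).
Proof.
split=> [s|]; first by rewrite ler0n.
rewrite (esumID [set k]); last by move=> s _; rewrite lee_fin ler0n.
rewrite setTI esum_set1 ?eqxx ?lee_fin ?ler01// esum1 ?adde0//.
by move=> s [_ /= /eqP/negPf ->].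
Qed.

Definition point_mass (S : choiceType) (k : S) : distr S :=
  Distr (point_mass_subproof k).

(* The distribution with mass function [f]; [d] if [f] is not one. *)
Definition distr_of (S : choiceType) (d : distr S) (f : S -> R) : distr S :=
  match pselect (is_pmf f) with left h => Distr h | right _ => d end.

(* The sum of an absolutely summable (possibly signed) family indexed by Z. *)
Definition zsum (f : int -> R) : R :=
  fine (\esum_(n in [set: int]) ((EFin \o f)^\+ n)
        - \esum_(n in [set: int]) ((EFin \o f)^\- n))%E.

Lemma ge0_zsum (f : int -> R) : (forall n, 0 <= f n) ->
  zsum f = fine (\esum_(n in [set: int]) (f n)%:E)%E.
Proof.
move=> f0; rewrite /zsum.
rewrite [X in (_ - X)%E]esum1 => [|n _].
  rewrite sube0; congr fine; apply: eq_esum => n _ /=.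
  by rewrite funeposE /=; apply/max_idPl; rewrite lee_fin.
by rewrite funenegE /=; apply/max_idPr; rewrite lee_fin oppr_le0.
Qed.

End Distributions.
Arguments distr : clear implicits.
Arguments point_mass {R S} k.

(* States, signals, messages and actions, all ranging over {-1, 1}, are
   booleans; [true] stands for 1 and [false] for -1. *)
Definition pm (b : bool) : int := if b then 1 else -1.

Section Model.
Context {R : realType}.
Variable p : R.

Definition strategy := int -> bool -> distr R bool.

Definition mechanism := distr R int -> strategy.

Implicit Types (eta : distr R int) (theta : strategy) (phi : mechanism).

Definition Q (y w : bool) : R := if y == w then 1 - p else p.

Definition q (w : bool) (n : int) : R :=
  let r := ((1 - p) / p) ^ n in (if w then r else 1) / (r + 1).

Definition action_mass eta (a : bool) theta : R :=
  \sum_(w : bool) \sum_(m : bool)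
    zsum (fun n => eta n * q w n * Q m w * theta n m a).

Definition update_mass eta (a : bool) theta (n' : int) : R :=
  (\sum_(w : bool) \sum_(m : bool)
     eta (n' - pm m) * q w (n' - pm m) * Q m w * theta (n' - pm m) m a)
  / action_mass eta a theta.

(* When [a] has probability 0 the belief is left unchanged; see [updateE]. *)
Definition update eta (a : bool) theta : distr R int :=
  distr_of eta (update_mass eta a theta).

(* Agents are numbered from 0, so index [t] is the agent of period [t + 1]:
   [belief phi a t] is the public belief held just before that agent acts, and
   it depends on [a 0], ..., [a (t - 1)] only. *)
Fixpoint belief phi (a : nat -> bool) (t : nat) : distr R int :=
  if t is s.+1 then
    update (belief phi a s) (a s) (phi (belief phi a s))
  else point_mass 0.

Definition summary (m : nat -> bool) (t : nat) : int := \sum_(s < t) pm (m s).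

(* A realization of the model under [phi] on some probability space.  Reports
   are truthful, so the signals are also the messages.  The law of (W, Y, A) is
   given by its values on cylinders: W is uniform, the Y_s are i.i.d. given W,
   and A_s is drawn from theta_s(. | n_s, Y_s). *)
Record process phi := Process {
  process_display : measure_display;
  sample : measurableType process_display;
  prob : probability sample R;
  state : {RV prob >-> bool};
  signal : nat -> {RV prob >-> bool};
  action : nat -> {RV prob >-> bool};
  process_law : forall (t : nat) (w : bool) (y a : nat -> bool),
    prob [set x | state x = w /\
                  forall s, (s < t)%N -> signal s x = y s /\ action s x = a s]
    = (2^-1 * \prod_(s < t)
         (Q (y s) w * phi (belief phi a s) (summary y s) (y s) (a s)))%:E
}.

(* [gamma eta y] is a (possibly mixed) optimal action of an agent who observes
   only the public history and her own signal. *)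
Definition optimal_nonjoining (gamma : distr R int -> bool -> distr R bool) :=
  forall eta (y a : bool), gamma eta y a != 0 -> forall b : bool,
    Q y b * zsum (fun n => eta n * q b n)
    <= Q y a * zsum (fun n => eta n * q a n).

Definition expected_utility eta theta : R :=
  \sum_(y : bool) \sum_(w : bool)
    zsum (fun n => Q y w * eta n * q w n * theta n y w).

Section Tax.
Variable gamma : distr R int -> bool -> distr R bool.

Definition tax eta theta : R :=
  \sum_(y : bool) \sum_(w : bool)
    zsum (fun n => Q y w * eta n * q w n * (theta n y w - gamma eta y w)).

Definition individually_rational phi := forall eta,
  expected_utility eta (fun _ y => gamma eta y)
  <= expected_utility eta (phi eta) - tax eta (phi eta).

Definition truth_telling phi := forall eta (y : bool),
  0 <= \sum_(w : bool)
         zsum (fun n => Q y w * eta n * q w n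
                        * (phi eta n y w - phi eta n (~~ y) w)).

Definition nonnegative_tax phi := forall eta, 0 <= tax eta (phi eta).

Definition NT_FPM phi :=
  [/\ individually_rational phi, truth_telling phi & nonnegative_tax phi].

Section Welfare.
Variables (phi : mechanism) (X : process phi).

Definition public_belief (t : nat) (x : sample X) : distr R int :=
  belief phi (fun s => action X s x) t.

Definition utility (t : nat) (x : sample X) : R :=
  (action X t x == state X x)%:R.

Definition paid_tax (t : nat) (x : sample X) : R :=
  tax (public_belief t x) (phi (public_belief t x)).

Definition net_utility (t : nat) (x : sample X) : R :=
  utility t x - paid_tax t x.

Definition NSW (delta : R) (x : sample X) : R :=
  limn (series (fun t => delta ^+ t * net_utility t x)).

(* Undiscounted, hence possibly infinite. *)
Definition revenue (x : sample X) : \bar R :=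
  (\sum_(0 <= t <oo) (paid_tax t x)%:E)%E.

End Welfare.
End Tax.

Definition thetaL : strategy := fun _ m => point_mass m.
Definition thetaCp : strategy := fun _ _ => point_mass true.
Definition thetaCm : strategy := fun _ _ => point_mass false.
Definition thetaN : strategy := fun n m =>
  point_mass (if n + pm m != 0 then 0 < n + pm m else 0 < n).

Definition ell eta : R :=
  zsum (fun n => eta n * q true n) / zsum (fun n => eta n * q false n).

Definition learning eta : bool := p / (1 - p) <= ell eta <= (1 - p) / p.

Definition BHW : mechanism := fun eta =>
  if learning eta then thetaL
  else if (1 - p) / p < ell eta then thetaCp else thetaCm.

Definition NSII : mechanism := fun eta =>
  if learning eta then thetaL else thetaN.

Lemma Q_itv (y w : bool) : 0 < p < 1 -> 0 <= Q y w <= 1.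
Proof. by move=> /andP[p0 p1]; rewrite /Q; case: ifP => _; lra. Qed.

Lemma q_itv (w : bool) (n : int) : 0 < p < 1 -> 0 <= q w n <= 1.
Proof.
move=> /andP[p0 p1]; rewrite /q; set r := (_ / _) ^ n.
have r0 : 0 <= r by rewrite exprz_ge0// divr_ge0//; lra.
rewrite divr_ge0 ?addr_ge0//=; last by case: w.
by rewrite ler_pdivrMr ?mul1r; case: w; lra.
Qed.

End Model.
Arguments utility {R p phi} X t x.
Arguments paid_tax {R p} gamma {phi} X t x.
Arguments net_utility {R p} gamma {phi} X t x.
Arguments NSW {R p} gamma {phi} X delta x.
Arguments revenue {R p} gamma {phi} X x.

Lemma mass_le1 (R : realType) (S : choiceType) (d : distr R S) (s : S) :
  d s <= 1.
Proof.
rewrite -lee_fin -(massP d).2; apply: esum_ge; exists [set s].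
  by split=> //; exact: finite_set1.
by rewrite fsbig_set1.
Qed.

Lemma esumZl (R : realType) (S : choiceType) (c : R) (f : S -> R) : 0 < c ->
  (\esum_(s in [set: S]) (c * f s)%:E
   = c%:E * \esum_(s in [set: S]) (f s)%:E)%E.
Proof.
have le (b : R) (g : S -> R) : 0 < b ->
    (\esum_(s in [set: S]) (b * g s)%:E
     <= b%:E * \esum_(s in [set: S]) (g s)%:E)%E.
  move=> b0; apply: ge_ereal_sup => _ [A [finA AT]] <-.
  rewrite fsbig_finite//= sumEFin -mulr_sumr EFinM -sumEFin.
  apply: lee_wpmul2l; first by rewrite lee_fin ltW.
  by apply: esum_ge; exists A => //; rewrite fsbig_finite.
move=> c0; apply/eqP; rewrite eq_le le//= -lee_pdivlMl//.
have ci0 : 0 < c^-1 by rewrite invr_gt0.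
apply: le_trans (le _ (fun s => c * f s) ci0).
by apply: le_esum => s _; rewrite mulKf ?gt_eqF.
Qed.

Lemma updateE (R : realType) (p : R) (eta : distr R int) (a : bool)
    (theta : strategy) : 0 < p < 1 -> action_mass p eta a theta != 0 ->
  update p eta a theta =1 update_mass p eta a theta.
Proof.
move=> p01 D0.
pose g n w m : R := eta n * q p w n * Q p m w * theta n m a.
have g0 n w m : 0 <= g n w m.
  have /andP[Q0 _] := Q_itv m w p01; have /andP[q0 _] := q_itv w n p01.
  exact: mulr_ge0 (mulr_ge0 (mulr_ge0 (mass_ge0 _ _) q0) Q0) (mass_ge0 _ _).
have gle n w m : g n w m <= eta n.
  have /andP[Q0 Q1] := Q_itv m w p01; have /andP[q0 q1] := q_itv w n p01.
  have t0 := mass_ge0 (theta n m) a; have t1 := mass_le1 (theta n m) a.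
  have qQ0 := mulr_ge0 q0 Q0; have qQ1 := mulr_ile1 q0 Q0 q1 Q1.
  rewrite /g -(mulrA (eta n)) -mulrA.
  exact: ler_piMr (mass_ge0 _ _) (mulr_ile1 qQ0 t0 qQ1 t1).
pose G w m := (\esum_(n in [set: int]) (g n w m)%:E)%E.
have Gfin w m : G w m \is a fin_num.
  rewrite ge0_fin_numE ?esum_ge0// => [|n _]; last by rewrite lee_fin.
  apply: (@le_lt_trans _ _ 1%E); rewrite ?ltry// -(massP eta).2.
  by apply: le_esum => n _; rewrite lee_fin.
have DE : (action_mass p eta a theta)%:E
    = (\sum_(w : bool) \sum_(m : bool) G w m)%E.
  rewrite /action_mass -sumEFin; apply: eq_bigr => w _.
  rewrite -sumEFin; apply: eq_bigr => m _.
  rewrite ge0_zsum; first exact/fineK/Gfin.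
  by move=> n; exact: g0.
have Dge0 : 0 <= action_mass p eta a theta.
  by rewrite -lee_fin DE; do 2!apply: sume_ge0 => ? _;
     apply: esum_ge0 => n _; rewrite lee_fin.
have h : is_pmf (update_mass p eta a theta).
  split=> [n|].
    apply: divr_ge0 => //; apply: sumr_ge0 => w _; apply: sumr_ge0 => m _.
    exact: g0.
  rewrite /update_mass; set D := action_mass _ _ _ _ in D0 DE Dge0 *.
  have Dgt0 : 0 < D by rewrite lt_neqAle eq_sym D0.
  under eq_esum => n _ do rewrite mulrC.
  rewrite esumZl ?invr_gt0//.
  suff -> : (\esum_(n in [set: int])
      (\sum_(w : bool) \sum_(m : bool) g (n - pm m) w m)%:E = D%:E)%E.
    by rewrite -EFinM mulVf.
  rewrite DE; under eq_esum => n _ do rewrite -sumEFin.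
  rewrite esum_sum => [|n w _ _]; last by rewrite lee_fin sumr_ge0.
  apply: eq_bigr => w _; under eq_esum => n _ do rewrite -sumEFin.
  rewrite esum_sum => [|n m _ _]; last by rewrite lee_fin.
  apply: eq_bigr => m _.
  have bij : set_bij [set: int] [set: int] (fun n => n - pm m).
    split=> //; first by move=> x y _ _ /addIr.
    by move=> n _; exists (n + pm m); rewrite ?addrK.
  exact: esym (@reindex_esum _ _ _ _ _ _ _ bij).
by move=> n; rewrite /update /distr_of; case: pselect.
Qed.

(* Main.v *)
(** With the profit-maximizing tax, an agent's expected net utility given the
public history is what she would get on her own: the sum over y of
max_a Q(y|a) P(W = a | history), a convex function of the posterior of W.
Along any mechanism the posterior is a martingale, so this value is
nondecreasing in expectation.  NSII and BHW coincide until the belief leaves the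
learning region; from then on BHW freezes the posterior, whereas NSII may still
reveal information.  After the actions +, +, +, + NSII gives the summary 0
positive probability, so the fifth action can be -; this brings the posterior
odds of W = 1 down to at most 1.  This split makes the comparison strict from
the sixth agent on and makes the fifth agent's tax positive. *)

Require Import Defs.
From HB Require Import structures.
From mathcomp Require Import all_boot all_order all_algebra.
From mathcomp Require Import ring lra zify.
From mathcomp Require Import all_classical all_reals all_analysis.
From mathcomp Require Import measurable_realfun.

Set Implicit Arguments.
Unset Strict Implicit.
Unset Printing Implicit Defensive.

Import Order.TTheory GRing.Theory Num.Theory.
Import numFieldNormedType.Exports.

Local Open Scope classical_set_scope.
Local Open Scope ring_scope.

(** The comparison is settled on beliefs, through the recursion [value], and only then transferred
    to a realization of the process. Two difficulties shape this. The public belief concerns the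
    summary, not W: the summary being sufficient for W, averaging q(w | n) recovers the posterior,
    and Bayes' rule for the summary entails Bayes' rule for W. And an action may have probability 0:
    posteriors are kept multiplied by the probability of the action, and the convex function is
    taken homogeneous, so that no division occurs. The number of initial actions comes from the
    odds. With r = (1-p)/p, two actions +1 reveal two signals and lift the odds to r^2 > r, outside
    the learning region. The next two actions +1 are certain and say nothing about W, but the hidden
    signals may bring the summary from 2 down to 0, where one more signal -1 produces the action
    -1. *)

(** * Linearity and translation of sums over the integers *)

Section SignedSums.
Context {R : realType}.
Implicit Types f g : int -> R.

Definition zsummable f := summable [set: int] (fun n => (f n)%:E).

Lemma le_zsummable f g :
  (forall n, `|f n| <= g n) -> zsummable g -> zsummable f.
Proof.
move=> fg; apply: le_lt_trans; apply: le_esum => n _ /=.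
by rewrite lee_fin (le_trans (fg n))// ler_norm.
Qed.

Lemma zsummable_norm f : zsummable f -> zsummable (fun n => `|f n|).
Proof.
apply: le_lt_trans; apply: le_esum => n _ /=.
by rewrite normr_id.
Qed.

Lemma zsummableD f g : zsummable f -> zsummable g ->
  zsummable (fun n => f n + g n).
Proof. by move=> sf sg; have := summableD sf sg. Qed.

Lemma ge0_esum_zsum f : (forall n, 0 <= f n) -> zsummable f ->
  (\esum_(n in [set: int]) (f n)%:E)%E = (zsum f)%:E.
Proof.
move=> f0 sf; rewrite ge0_zsum// fineK//.
have := sf; rewrite -[zsummable f]/(summable _ _) summableE.
by under eq_esum => n _ do rewrite gee0_abs ?lee_fin//.
Qed.

(** The bridge to signed families: linearity is known for nonnegative ones, and every summable
    family is a difference of two of these. *)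
Lemma ge0_zsumB f g : (forall n, 0 <= f n) -> (forall n, 0 <= g n) ->
  zsummable f -> zsummable g -> zsum (fun n => f n - g n) = zsum f - zsum g.
Proof.
move=> f0 g0 sf sg; apply: EFin_inj; rewrite EFinB.
rewrite -(ge0_esum_zsum f0 sf) -(ge0_esum_zsum g0 sg).
rewrite -(esumB sf sg) => [|n _|n _]; [|by rewrite lee_fin..].
rewrite /zsum fineK//.
(* [fineK] asks that both parts of the difference be finite, which follows from summability. *)
rewrite fin_numB.
have sh : zsummable (fun n => f n - g n).
  by have := summableB sf sg.
have := summable_funepos sh; have := summable_funeneg sh.
rewrite !summableE => h1 h2; apply/andP; split.
  move: h2; under eq_esum => n _ do rewrite gee0_abs ?funepos_ge0//.
  by [].
move: h1; under eq_esum => n _ do rewrite gee0_abs ?funeneg_ge0//.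
by [].
Qed.

Lemma ge0_zsumD f g : (forall n, 0 <= f n) -> (forall n, 0 <= g n) ->
  zsummable f -> zsummable g -> zsum (fun n => f n + g n) = zsum f + zsum g.
Proof.
move=> f0 g0 sf sg; apply: EFin_inj; rewrite EFinD -!ge0_esum_zsum//.
- by rewrite -esumD// => n _; rewrite lee_fin.
- by move=> n; rewrite addr_ge0.
- exact: zsummableD.
Qed.

Lemma zsumD f g : zsummable f -> zsummable g ->
  zsum (fun n => f n + g n) = zsum f + zsum g.
Proof.
move=> sf sg.
(* The positive and negative parts, written through the norm so that [lra] and [field] can treat
   them. *)
pose pos (h : int -> R) n : R := (`|h n| + h n) / 2.
pose neg (h : int -> R) n : R := (`|h n| - h n) / 2.
have pos0 h n : 0 <= pos h n.
  by rewrite /pos; have := ler_norm (- h n); rewrite normrN; lra.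
have neg0 h n : 0 <= neg h n by rewrite divr_ge0// subr_ge0 ler_norm.
have sp h : zsummable h -> zsummable (pos h).
  move=> sh; apply: le_zsummable (zsummable_norm sh) => n.
  rewrite ger0_norm// /pos; have := ler_norm (h n); lra.
have sn h : zsummable h -> zsummable (neg h).
  move=> sh; apply: le_zsummable (zsummable_norm sh) => n.
  rewrite ger0_norm// /neg; have := ler_norm (- h n); rewrite normrN; lra.
have E h : zsummable h -> zsum h = zsum (pos h) - zsum (neg h).
  move=> sh; rewrite -ge0_zsumB//; [|exact: sp|exact: sn].
  by congr zsum; apply/funext => n; rewrite /pos /neg; field.
rewrite (E f)// (E g)// addrACA -opprD -!ge0_zsumD//;
  [|exact: sn..|exact: sp|exact: sp].
rewrite -ge0_zsumB.
- by congr zsum; apply/funext => n; rewrite /pos /neg; field.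
- by move=> n; rewrite addr_ge0.
- by move=> n; rewrite addr_ge0.
- by apply: zsummableD; apply: sp.
- by apply: zsummableD; apply: sn.
Qed.

Lemma zsum0 : zsum (fun _ => 0 : R) = 0.
Proof. by rewrite ge0_zsum// esum1. Qed.

Lemma zsumN f : zsummable f -> zsum (fun n => - f n) = - zsum f.
Proof.
move=> sf; apply/eqP; rewrite -addr_eq0 -zsumD//; last first.
  by apply: le_zsummable (zsummable_norm sf) => n; rewrite normrN.
rewrite -[X in _ == X]zsum0; apply/eqP; congr zsum.
by apply/funext => n; rewrite addNr.
Qed.

Lemma zsummableZ c f : zsummable f -> zsummable (fun n => c * f n).
Proof.
move=> sf; rewrite /zsummable /summable.
have [->|c0] := eqVneq c 0.
  by rewrite esum1 ?ltry// => n _; rewrite mul0r abse0.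
under eq_esum => n _ do rewrite abse_EFin normrM.
rewrite esumZl ?normr_gt0//; apply: lte_mul_pinfty => //.
Qed.

Lemma ge0_zsumZ c f : 0 <= c -> zsummable f -> (forall n, 0 <= f n) ->
  zsum (fun n => c * f n) = c * zsum f.
Proof.
rewrite le_eqVlt => /predU1P[<- _ _|c0 sf f0].
  by rewrite mul0r -[RHS]zsum0; congr zsum; apply/funext => n; rewrite mul0r.
apply: EFin_inj; rewrite EFinM -!ge0_esum_zsum//; first exact: esumZl.
- by move=> n; rewrite mulr_ge0// ltW.
- exact: zsummableZ.
Qed.

Lemma zsumZ c f : zsummable f -> zsum (fun n => c * f n) = c * zsum f.
Proof.
move=> sf.
wlog c0 : c / 0 <= c => [hw|].
  have [/hw//|/ltW c0] := leP 0 c.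
  rewrite -[c]opprK mulNr -hw ?oppr_ge0// -zsumN; last exact: zsummableZ.
  by congr zsum; apply/funext => n; rewrite mulNr.
(* Here f is split as (|f| + f) - |f|, a difference of nonnegative families. *)
pose pos n : R := `|f n| + f n.
have pos0 n : 0 <= pos n.
  by rewrite /pos; have := ler_norm (- f n); rewrite normrN; lra.
have sn := zsummable_norm sf.
have sp : zsummable pos by apply: zsummableD.
have -> : zsum f = zsum pos - zsum (fun n => `|f n|).
  rewrite -ge0_zsumB//; congr zsum; apply/funext => n.
  by rewrite /pos addrAC subrr add0r.
rewrite mulrBr -!(ge0_zsumZ c0)//.
rewrite -ge0_zsumB; [|by move=> n; rewrite mulr_ge0..|
  exact: zsummableZ sp|exact: zsummableZ sn].
by congr zsum; apply/funext => n; rewrite /pos; ring.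
Qed.

Lemma zsum_ge0 f : (forall n, 0 <= f n) -> 0 <= zsum f.
Proof.
by move=> f0; rewrite ge0_zsum// fine_ge0// esum_ge0// => n _; rewrite lee_fin.
Qed.

Lemma ge_zsum f n : (forall n, 0 <= f n) -> zsummable f -> f n <= zsum f.
Proof.
move=> f0 sf; rewrite -lee_fin -ge0_esum_zsum//; apply: esum_ge.
exists [set n]; last by rewrite fsbig_set1.
by split=> //; exact: finite_set1.
Qed.

Lemma le_zsum f g : zsummable f -> zsummable g -> (forall n, f n <= g n) ->
  zsum f <= zsum g.
Proof.
move=> sf sg fg; rewrite -subr_ge0 -mulN1r -zsumZ// -zsumD//; last first.
  exact: zsummableZ.
by apply: zsum_ge0 => n; rewrite mulN1r subr_ge0.
Qed.

Lemma zsummable_shift k f : zsummable f -> zsummable (fun n => f (n - k)).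
Proof.
suff E : (\esum_(n in [set: int]) `|(f n)%:E|
  = \esum_(n in [set: int]) `|(f (n - k))%:E|)%E.
  by rewrite /zsummable /summable E.
apply: (@reindex_esum _ _ _ _ _ (fun n : int => n - k)); split => //.
  by move=> x y _ _ /addIr.
by move=> n _; exists (n + k); rewrite ?addrK.
Qed.

Lemma zsum_shift k f : (forall n, 0 <= f n) ->
  zsum (fun n => f (n - k)) = zsum f.
Proof.
move=> f0; rewrite !ge0_zsum//; congr fine; apply: esym.
apply: (@reindex_esum _ _ _ _ _ (fun n : int => n - k)); split => //.
  by move=> x y _ _ /addIr.
by move=> n _; exists (n + k); rewrite ?addrK.
Qed.

End SignedSums.

(** * Averages of bounded functions against a belief *)

Section Averages.
Context {R : realType}.
Implicit Types (eta : distr R int) (f g : int -> R).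

(** Boundedness gives summability against every belief at once, and it is stable under the
    operations that build the integrands. *)
Definition bounded g := exists C, forall n, `|g n| <= C.

Definition avg eta g : R := zsum (fun n => eta n * g n).

Lemma eq_avg eta f g : (forall n, eta n != 0 -> f n = g n) ->
  avg eta f = avg eta g.
Proof.
move=> fg; congr zsum; apply/funext => n.
by have [->|/fg->//] := eqVneq (eta n) 0; rewrite !mul0r.
Qed.

Lemma zsummable_mass eta : zsummable eta.
Proof.
rewrite /zsummable /summable.
under eq_esum => n _ do rewrite gee0_abs ?lee_fin ?mass_ge0//.
by rewrite (massP eta).2 ltry.
Qed.

Lemma zsummable_avg eta g : bounded g -> zsummable (fun n => eta n * g n).
Proof.
move=> [C gC]; apply: le_zsummable (zsummableZ C (zsummable_mass eta)) => n.
by rewrite normrM ger0_norm ?mass_ge0// mulrC ler_wpM2r// mass_ge0.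
Qed.

Lemma bounded_cst (c : R) : bounded (fun _ => c).
Proof. by exists `|c|. Qed.

Lemma boundedD f g : bounded f -> bounded g -> bounded (fun n => f n + g n).
Proof.
move=> [C fC] [D gD]; exists (C + D) => n.
by rewrite (le_trans (ler_normD _ _))// lerD.
Qed.

Lemma boundedN f : bounded f -> bounded (fun n => - f n).
Proof. by move=> [C fC]; exists C => n; rewrite normrN. Qed.

Lemma boundedM f g : bounded f -> bounded g -> bounded (fun n => f n * g n).
Proof.
move=> [C fC] [D gD]; exists (C * D) => n.
by rewrite normrM ler_pM.
Qed.

Lemma bounded_bool (F : bool -> int -> R) : (forall b, bounded (F b)) ->
  bounded (fun n => \sum_(b : bool) F b n).
Proof.
move=> FC; have := boundedD (FC true) (FC false).
by congr bounded; apply/funext => n; rewrite big_bool.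
Qed.

Lemma bounded_shift k g : bounded g -> bounded (fun n => g (n + k)).
Proof. by move=> [C gC]; exists C. Qed.

Lemma bounded_itv g : (forall n, 0 <= g n <= 1) -> bounded g.
Proof.
by move=> g01; exists 1 => n; have /andP[g0 g1] := g01 n; rewrite ger0_norm.
Qed.

Lemma bounded_mass (F : int -> distr R bool) a : bounded (fun n => F n a).
Proof. by apply: bounded_itv => n; rewrite mass_ge0 mass_le1. Qed.

Lemma avgD eta f g : bounded f -> bounded g ->
  avg eta (fun n => f n + g n) = avg eta f + avg eta g.
Proof.
move=> bf bg; rewrite /avg -zsumD; [|exact: zsummable_avg..].
by congr zsum; apply/funext => n; rewrite mulrDr.
Qed.

Lemma avgZ eta c f : bounded f -> avg eta (fun n => c * f n) = c * avg eta f.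
Proof.
move=> bf; rewrite /avg -zsumZ; last exact: zsummable_avg.
by congr zsum; apply/funext => n; rewrite mulrCA.
Qed.

Lemma avgB eta f g : bounded f -> bounded g ->
  avg eta (fun n => f n - g n) = avg eta f - avg eta g.
Proof.
move=> bf bg; rewrite -mulN1r -avgZ// -avgD//; last first.
  by apply: boundedM => //; apply: bounded_cst.
by apply: eq_avg => n _; rewrite mulN1r.
Qed.

Lemma avg_bool eta (F : bool -> int -> R) : (forall b, bounded (F b)) ->
  avg eta (fun n => \sum_(b : bool) F b n) = \sum_(b : bool) avg eta (F b).
Proof.
move=> FC; rewrite big_bool /= -avgD//.
by apply: eq_avg => n _; rewrite big_bool.
Qed.

Lemma le_avg eta f g : bounded f -> bounded g ->
  (forall n, eta n != 0 -> f n <= g n) -> avg eta f <= avg eta g.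
Proof.
move=> bf bg fg; apply: le_zsum => [||n]; [exact: zsummable_avg..|].
have [->|/fg fgn] := eqVneq (eta n) 0; first by rewrite !mul0r.
by rewrite ler_wpM2l// mass_ge0.
Qed.

Lemma avg_ge0 eta g : (forall n, 0 <= g n) -> 0 <= avg eta g.
Proof. by move=> g0; apply: zsum_ge0 => n; rewrite mulr_ge0// mass_ge0. Qed.

Lemma avg_gt0 eta g n : bounded g -> (forall n, 0 <= g n) ->
  0 < eta n -> 0 < g n -> 0 < avg eta g.
Proof.
move=> bg g0 en gn; have eg0 : 0 < eta n * g n by rewrite mulr_gt0.
apply: lt_le_trans eg0 _.
apply: (@ge_zsum _ (fun n => eta n * g n)); last exact: zsummable_avg.
by move=> m; rewrite mulr_ge0// mass_ge0.
Qed.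

Lemma avg1 eta : avg eta (fun _ => 1) = 1.
Proof.
apply: EFin_inj; rewrite /avg -ge0_esum_zsum.
- by under eq_esum do rewrite mulr1; exact: (massP eta).2.
- by move=> n; rewrite mulr1 mass_ge0.
- by apply: zsummable_avg; apply: bounded_cst.
Qed.

Lemma avg_point k g : avg (point_mass k) g = g k.
Proof.
rewrite (@eq_avg _ g (fun _ => g k * 1)) => [|n /=].
  by rewrite avgZ ?avg1 ?mulr1//; apply: bounded_cst.
by rewrite /mass /=; have [->|] := eqVneq n k; rewrite ?mulr1 ?eqxx.
Qed.

Lemma mass_gt0 eta : exists n, 0 < eta n.
Proof.
apply: contrapT => h; have := avg1 eta.
rewrite (@eq_avg eta _ (fun _ => 0 * 1)).
  rewrite avgZ; last by apply: bounded_cst.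
  by rewrite mul0r => /eqP; rewrite eq_sym oner_eq0.
move=> n en; exfalso; apply: h; exists n.
by rewrite lt_neqAle eq_sym en mass_ge0.
Qed.

End Averages.

(** Follows the syntax of the integrand down to constants, action probabilities and the functions
    registered in [bdd]. *)
Ltac bounded_tac := repeat (intros; match goal with
  | |- bounded _ => eassumption
  | |- bounded (fun _ => _) => simple apply bounded_cst
  | |- bounded (fun n => (?F n) ?a) => exact (bounded_mass F a)
  | |- bounded (fun n => mass (@?F n) ?a) => exact (bounded_mass F a)
  | |- bounded (fun n => @?f n * @?g n) => apply (@boundedM _ f g)
  | |- bounded (fun n => @?f n + @?g n) => apply (@boundedD _ f g)
  | |- bounded (fun n => - @?f n) => apply (@boundedN _ f)
  | |- bounded (fun n => \sum_(b : bool) @?F n b) =>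
      apply (@bounded_bool _ (fun b n => F n b))
  | |- bounded (fun n => _ (n + ?k)) => apply: bounded_shift
  | _ => solve [auto with bdd]
  end).

(** * Bayesian updating, the convex value of information, and taxes *)

Section Beliefs.
Context {R : realType}.
Variable p : R.
Hypothesis hp : 0 < p < 2^-1.
Implicit Types (eta : distr R int) (theta : @strategy R) (phi : @mechanism R).

Let p0 : 0 < p. Proof. by case/andP: hp. Qed.
Let p2 : p < 2^-1. Proof. by case/andP: hp. Qed.
Let p01 : 0 < p < 1. Proof. by rewrite p0/=; have := p2; lra. Qed.
Let pN0 : p != 0. Proof. by rewrite gt_eqF. Qed.

Lemma mass_bool (d : distr R bool) : d true + d false = 1.
Proof.
apply: EFin_inj; rewrite -(massP d).2 (esumID [set true]) => [|s _]; last first.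
  by rewrite lee_fin mass_ge0.
rewrite setTI esum_set1 ?lee_fin ?mass_ge0//.
have -> : [set: bool] `&` ~` [set true] = [set false].
  by apply/seteqP; split=> -[]//= [].
by rewrite esum_set1 ?lee_fin ?mass_ge0.
Qed.

Lemma point_massE (b c : bool) : @point_mass R bool b c = (c == b)%:R.
Proof. by []. Qed.

Lemma Q_gt0 y w : 0 < Q p y w.
Proof. by rewrite /Q; case: ifP => _; have := p0; have := p2; lra. Qed.

Lemma Q_ge0 y w : 0 <= Q p y w. Proof. exact/ltW/Q_gt0. Qed.

Lemma Q_sum w : Q p true w + Q p false w = 1.
Proof. by rewrite /Q; case: w => /=; ring. Qed.

Let r : R := (1 - p) / p.

Let r_gt1 : 1 < r.
Proof. by rewrite /r ltr_pdivlMr ?p0//; have := p2; lra. Qed.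

Let r_gt0 : 0 < r. Proof. exact: lt_trans r_gt1. Qed.

Let r_exp_gt0 (n : int) : 0 < r ^ n. Proof. exact: exprz_gt0. Qed.

Lemma q_gt0 w n : 0 < q p w n.
Proof. by rewrite /q divr_gt0 ?addr_gt0//; case: w. Qed.

Lemma q_ge0 w n : 0 <= q p w n. Proof. exact/ltW/q_gt0. Qed.

Lemma q_sum n : q p true n + q p false n = 1.
Proof. by rewrite /q -mulrDl divff// gt_eqF// addr_gt0. Qed.

Lemma bounded_q w : bounded (q p w).
Proof. by apply: bounded_itv => n; apply: q_itv. Qed.
#[local] Hint Resolve bounded_q : bdd.

(* The summary n is sufficient for W: Bayes' rule maps (n, m) to n + m. *)
Lemma q_bayes w n m :
  q p w (n + pm m) * (\sum_(v : bool) q p v n * Q p m v) = q p w n * Q p m w.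
Proof.
have h1 : r ^ (n + 1) = r ^ n * r by rewrite expfzDr ?gt_eqF.
have h2 : r ^ (n - 1) = r ^ n / r by rewrite expfzDr ?gt_eqF.
have x0 := r_exp_gt0 n.
have pp := p0; have pp2 := p2.
rewrite big_bool /= /q -/r /pm /Q; case: m; rewrite ?h1 ?h2; set x := r ^ n;
  rewrite -/x in x0; rewrite /r; case: w => /=; field.
all: rewrite ?pN0/= ?gt_eqF//=; try nra.
all: by rewrite addr_gt0 ?mulr_gt0//; lra.
Qed.

Lemma q_le n w : (if w then n <= 0 else 0 <= n) -> q p w n <= q p (~~ w) n.
Proof.
rewrite /q -/r => h; rewrite ler_pM2r ?invr_gt0 ?addr_gt0//.
have r1 : 1 <= r by apply: ltW.
case: w h => /= h; last by rewrite -(expr0z r) ler_weXz2l.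
by rewrite -(expr0z r) ler_weXz2l.
Qed.

(** By [q_bayes] both sides are posteriors at [n + pm m] times a common factor, so the sign of the
    new summary decides which action is better. *)
Lemma qQ_le w n m : (if w then n + pm m <= 0 else 0 <= n + pm m) ->
  q p w n * Q p m w <= q p (~~ w) n * Q p m (~~ w).
Proof.
move=> h; rewrite -!q_bayes ler_wpM2r ?q_le//.
by apply: sumr_ge0 => v _; rewrite mulr_ge0 ?q_ge0 ?Q_ge0.
Qed.

(** The posterior probability of W = w given the public history. *)
Definition likelihood eta w : R := avg eta (q p w).

(** The probability, given the public history, that W = w and the next action is a. *)
Definition joint_mass eta theta w a : R :=
  avg eta (fun n => q p w n * \sum_(m : bool) Q p m w * theta n m a).

Lemma likelihood_gt0 eta w : 0 < likelihood eta w.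
Proof.
have [n en] := mass_gt0 eta.
by apply: (avg_gt0 (bounded_q w) (q_ge0 w) en); exact: q_gt0.
Qed.

Lemma likelihood_sum eta : likelihood eta true + likelihood eta false = 1.
Proof.
rewrite -avgD; [|exact: bounded_q..]; rewrite -[RHS](avg1 eta).
by apply: eq_avg => n _; rewrite q_sum.
Qed.

Lemma ellE eta : ell p eta = likelihood eta true / likelihood eta false.
Proof. by []. Qed.

(** With denominators cleared, the region is linear in the posterior, a form that [nra] can use. *)
Lemma learningE eta : learning p eta =
  (p * likelihood eta false <= (1 - p) * likelihood eta true) &&
  (p * likelihood eta true <= (1 - p) * likelihood eta false).
Proof.
rewrite /learning ellE; have l1 := likelihood_gt0 eta true.
have l0 := likelihood_gt0 eta false; have q0 : 0 < 1 - p by have := p2; lra.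
congr andb; first by rewrite ler_pdivlMr// mulrAC ler_pdivrMr// [leRHS]mulrC.
by rewrite ler_pdivrMr// mulrAC ler_pdivlMr// [leLHS]mulrC.
Qed.

Lemma ell_gtE eta : ((1 - p) / p < ell p eta) =
  ((1 - p) * likelihood eta false < p * likelihood eta true).
Proof.
rewrite ellE; have l0 := likelihood_gt0 eta false.
by rewrite ltr_pdivlMr// mulrAC ltr_pdivrMr ?p0// [ltRHS]mulrC.
Qed.

Lemma bounded_joint theta w a :
  bounded (fun n => q p w n * \sum_(m : bool) Q p m w * theta n m a).
Proof. by bounded_tac. Qed.

Lemma joint_mass_ge0 eta theta w a : 0 <= joint_mass eta theta w a.
Proof.
apply: avg_ge0 => n; rewrite mulr_ge0 ?q_ge0//.
by apply: sumr_ge0 => m _; rewrite mulr_ge0 ?Q_ge0 ?mass_ge0.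
Qed.

Lemma joint_mass_sum eta theta w :
  joint_mass eta theta w true + joint_mass eta theta w false = likelihood eta w.
Proof.
rewrite -avgD; [|exact: bounded_joint..]; apply: eq_avg => n _.
rewrite -mulrDr !big_bool /= addrACA -!mulrDr !mass_bool !mulr1.
by rewrite Q_sum mulr1.
Qed.

Lemma action_massE eta a theta :
  action_mass p eta a theta = \sum_(w : bool) joint_mass eta theta w a.
Proof.
apply: eq_bigr => w _; rewrite /joint_mass.
under [in RHS]eq_avg do rewrite mulr_sumr.
rewrite avg_bool => [|m]; last first.
  by bounded_tac.
by apply: eq_bigr => m _; congr zsum; apply/funext => n; rewrite !mulrA.
Qed.

Lemma action_mass_ge0 eta a theta : 0 <= action_mass p eta a theta.
Proof. by rewrite action_massE sumr_ge0// => w _; exact: joint_mass_ge0. Qed.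

Lemma action_mass_sum eta theta :
  action_mass p eta true theta + action_mass p eta false theta = 1.
Proof.
rewrite -(likelihood_sum eta) -2!(joint_mass_sum eta theta).
rewrite 2!action_massE.
rewrite 2!big_bool.
exact: addrACA.
Qed.

(* When [a] has probability 0 both sides vanish, so the junk value of [update]
   is harmless. *)
Lemma update_avg eta theta w a (g : int -> R) :
  (forall n, 0 <= g n) -> bounded g ->
  avg eta (fun n => q p w n *
    \sum_(m : bool) Q p m w * theta n m a * g (n + pm m))
  = action_mass p eta a theta *
    avg (update p eta a theta) (fun n => q p w n * g n).
Proof.
move=> g0 bg.
have bj : bounded (fun n => q p w n *
    \sum_(m : bool) Q p m w * theta n m a * g (n + pm m)) by bounded_tac.
have [am0|amN0] := eqVneq (action_mass p eta a theta) 0.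
  rewrite am0 mul0r; apply/eqP; rewrite eq_le; apply/andP; split; last first.
    apply: avg_ge0 => n; rewrite mulr_ge0 ?q_ge0 ?sumr_ge0// => m _.
    by rewrite !mulr_ge0 ?Q_ge0 ?mass_ge0.
  have jm0 : joint_mass eta theta w a = 0.
    move: am0; rewrite action_massE big_bool /=.
    have := joint_mass_ge0 eta theta true a.
    have := joint_mass_ge0 eta theta false a.
    by case: w {bj}; lra.
  (* The left side is squeezed between 0 and C times the joint mass, which vanishes. *)
  have [C gC] := bg.
  rewrite [leRHS](_ : 0 = C * joint_mass eta theta w a); last first.
    by rewrite jm0 mulr0.
  rewrite -avgZ; last exact: bounded_joint.
  apply: le_avg => //; first by bounded_tac.
  move=> n _; rewrite mulrCA ler_wpM2l ?q_ge0// mulr_sumr ler_sum// => m _.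
  rewrite mulrC ler_wpM2r ?mulr_ge0 ?Q_ge0 ?mass_ge0//.
  by rewrite (le_trans (ler_norm _)).
pose h m n := eta n * (q p w n * Q p m w * theta n m a * g (n + pm m)).
have bh m : bounded (fun n => q p w n * Q p m w * theta n m a * g (n + pm m)).
  by bounded_tac.
have h0 m n : 0 <= h m n.
  by rewrite /h; do 4?apply: mulr_ge0; rewrite ?g0 ?q_ge0 ?Q_ge0 ?mass_ge0.
have sh m : zsummable (h m) by exact: (zsummable_avg eta (bh m)).
have -> : avg eta (fun n => q p w n *
    \sum_(m : bool) Q p m w * theta n m a * g (n + pm m))
    = zsum (h true) + zsum (h false).
  rewrite -zsumD//; congr zsum; apply/funext => n.
  by rewrite big_bool /h /=; ring.
rewrite -avgZ; last by bounded_tac.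
(* Each message has its own translation from the old summary to the new one, hence the split by
   message; [q_bayes] then matches the terms. *)
rewrite -(zsum_shift (pm true) (h0 true)) -(zsum_shift (pm false) (h0 false)).
rewrite -zsumD; [|exact: zsummable_shift..].
congr zsum; apply/funext => n; rewrite updateE// /update_mass.
rewrite [RHS]mulrA mulfVK//.
have B m := q_bayes w (n - pm m) m.
rewrite /h; have := B true; have := B false; rewrite !subrK => <- <-.
by rewrite !big_bool /=; ring.
Qed.

(** Bayes' rule for W, multiplied out so that it also covers actions of probability 0: [update_avg]
    with the constant test function 1. *)
Lemma likelihood_update eta theta w a :
  action_mass p eta a theta * likelihood (update p eta a theta) w
  = joint_mass eta theta w a.
Proof.
have := @update_avg eta theta w a (fun _ => 1) (fun=> ler01) (bounded_cst 1).
rewrite /joint_mass.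
under eq_avg do under eq_bigr do rewrite mulr1.
by move=> ->; congr (_ * _); apply: eq_avg => n _; rewrite mulr1.
Qed.

Lemma update_support eta theta a n : action_mass p eta a theta != 0 ->
  update p eta a theta n != 0 ->
  exists m, eta (n - pm m) != 0 /\ theta (n - pm m) m a != 0.
Proof.
move=> am; rewrite updateE// /update_mass => h; apply: contrapT => nh.
move/negP: h; apply; rewrite big1 ?mul0r// => w _; rewrite big1// => m _.
have [->|e0] := eqVneq (eta (n - pm m)) 0; first by rewrite !mul0r.
have [->|t0] := eqVneq (theta (n - pm m) m a) 0; first by rewrite mulr0.
by exfalso; apply: nh; exists m.
Qed.

Lemma update_gt0 eta theta a n m : action_mass p eta a theta != 0 ->
  0 < eta n -> 0 < theta n m a -> 0 < update p eta a theta (n + pm m).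
Proof.
move=> am en tn; rewrite updateE// /update_mass divr_gt0//; last first.
  by rewrite lt_neqAle eq_sym am action_mass_ge0.
have g0 w k : 0 <= eta (n + pm m - pm k) * q p w (n + pm m - pm k) * Q p k w
    * theta (n + pm m - pm k) k a.
  by do 3?apply: mulr_ge0; rewrite ?q_ge0 ?Q_ge0 ?mass_ge0.
rewrite (bigD1 true)//= ltr_pwDl//; last first.
  by apply: sumr_ge0 => w _; apply: sumr_ge0 => k _; exact: g0.
rewrite (bigD1 m)//= ltr_pwDl//; last by apply: sumr_ge0 => k _; exact: g0.
by rewrite addrK; do 3?apply: mulr_gt0; rewrite ?q_gt0 ?Q_gt0.
Qed.

Lemma joint_mass_certain eta theta a w :
  (forall n m, eta n != 0 -> theta n m a = 1) ->
  joint_mass eta theta w a = likelihood eta w.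
Proof.
move=> h; apply: eq_avg => n en; rewrite big_bool /= !h// !mulr1.
by rewrite Q_sum mulr1.
Qed.

Lemma action_mass_certain eta theta a :
  (forall n m, eta n != 0 -> theta n m a = 1) ->
  action_mass p eta a theta = 1.
Proof.
move=> h; rewrite action_massE big_bool /= !joint_mass_certain//.
exact: likelihood_sum.
Qed.

(** An action that is certain carries no information on W, although the belief about the summary may
    still spread. This serves both the BHW herds and the first steps of an NSII herd. *)
Lemma likelihood_certain eta theta a w :
  (forall n m, eta n != 0 -> theta n m a = 1) ->
  likelihood (update p eta a theta) w = likelihood eta w.
Proof.
move=> h; rewrite -(joint_mass_certain w h) -likelihood_update.
by rewrite action_mass_certain// mul1r.
Qed.

(* Homogeneous in [x], hence meaningful for the unnormalized vector of the
   P(W = w, history). *)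
Definition best (x : bool -> R) : R :=
  \sum_(y : bool) Num.max (Q p y true * x true) (Q p y false * x false).

Lemma bestZ c x : 0 <= c -> best (fun w => c * x w) = c * best x.
Proof.
move=> c0; rewrite /best mulr_sumr; apply: eq_bigr => y _.
by rewrite maxr_pMr// !(mulrCA c).
Qed.

(** Together with [bestZ] this is convexity, in the form suited to unnormalized vectors. *)
Lemma best_sub x y : best (fun w => x w + y w) <= best x + best y.
Proof.
rewrite /best -big_split; apply: ler_sum => m _ /=.
rewrite ge_max !mulrDr !lerD// le_max lexx ?orbT//.
Qed.

Lemma best_ge x b : x b <= best x.
Proof.
rewrite /best big_bool /=.
have -> : x b = Q p true b * x b + Q p false b * x b.
  by rewrite -mulrDl Q_sum mul1r.
by apply: lerD; rewrite le_max; case: b; rewrite lexx ?orbT.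
Qed.

Lemma best_gt x : 0 < x false -> x true <= x false -> x true < best x.
Proof.
(* The middle term is the payoff of following one's own signal; it beats [x true] because p < 1 -
   p. *)
move=> x0 le_x; apply: (@lt_le_trans _ _ ((1 - p) * x true + (1 - p) * x false)).
  by have := p0; have := p2; nra.
by rewrite /best big_bool /= /Q /= lerD// le_max lexx ?orbT.
Qed.

Definition public_value eta : R := best (likelihood eta).

Lemma public_value_certain eta theta a :
  (forall n m, eta n != 0 -> theta n m a = 1) ->
  public_value (update p eta a theta) = public_value eta.
Proof.
move=> h; rewrite /public_value; congr best; apply/funext => w.
exact: likelihood_certain.
Qed.

Lemma public_value_update eta theta a :
  action_mass p eta a theta * public_value (update p eta a theta)
  = best (fun w => joint_mass eta theta w a).
Proof.
rewrite -bestZ ?action_mass_ge0//; congr best; apply/funext => w.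
exact: likelihood_update.
Qed.

(** Jensen's inequality for the split of the posterior by the next action: the joint vectors of the
    two actions add up to the posterior. *)
Lemma public_value_convex eta theta : public_value eta <=
  \sum_(a : bool) action_mass p eta a theta * public_value (update p eta a theta).
Proof.
rewrite big_bool /= !public_value_update; apply: le_trans (best_sub _ _).
rewrite le_eqVlt; apply/orP; left; apply/eqP; congr best; apply/funext => w.
by rewrite joint_mass_sum.
Qed.

(** Beyond the upper threshold even a signal -1 does not overturn +1, so both maxima are attained at
    [true]. *)
Lemma public_value_gtE eta : (1 - p) / p < ell p eta ->
  public_value eta = likelihood eta true.
Proof.
rewrite ell_gtE => h; rewrite /public_value /best big_bool /= /Q /=.
have := p0; have := p2; have := likelihood_gt0 eta true.
have := likelihood_gt0 eta false => l0 l1 pp2 pp0.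
by rewrite !max_l; [ring|nra|nra].
Qed.

(* The expected net utility of the agent acting k periods after the public
   belief is [eta]. *)
Fixpoint value phi k eta : R :=
  if k is j.+1 then
    \sum_(a : bool) action_mass p eta a (phi eta)
                    * value phi j (update p eta a (phi eta))
  else public_value eta.

Lemma value_ge phi k eta : public_value eta <= value phi k eta.
Proof.
elim: k eta => //= k IH eta.
apply: le_trans (public_value_convex eta (phi eta)) _.
by apply: ler_sum => a _; rewrite ler_wpM2l ?action_mass_ge0.
Qed.

Lemma learning_certain eta theta a :
  (forall n m, eta n != 0 -> theta n m a = 1) ->
  learning p (update p eta a theta) = learning p eta.
Proof. by move=> h; rewrite !learningE !likelihood_certain. Qed.

Lemma value_BHW k eta : ~~ learning p eta ->
  value (BHW p) k eta = public_value eta.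
Proof.
elim: k eta => //= k IH eta nl.
(* BHW herds on one action [b]; only its branch has weight, and along it the posterior is
   unchanged. *)
have [b hb] : exists b, forall n m, eta n != 0 -> BHW p eta n m b = 1.
  rewrite /BHW (negPf nl); case: ifP => _; [exists true|exists false] => n m _;
  by rewrite /thetaCp /thetaCm point_massE eqxx.
have amb := action_mass_certain hb.
have amn : action_mass p eta (~~ b) (BHW p eta) = 0.
  by have := action_mass_sum eta (BHW p eta); case: b amb {hb} => /= ->; lra.
have h : value (BHW p) k (update p eta b (BHW p eta)) = public_value eta.
  by rewrite IH ?learning_certain// public_value_certain.
rewrite big_bool /=; case: b amb amn h {hb} => /= -> -> ->.
  by rewrite mul1r mul0r addr0.
by rewrite mul1r mul0r add0r.
Qed.

Lemma NSII_BHW eta : learning p eta -> NSII p eta = BHW p eta.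
Proof. by rewrite /NSII /BHW => ->. Qed.

Lemma value_BHW_le_NSII k eta : value (BHW p) k eta <= value (NSII p) k eta.
Proof.
have [le|nl] := boolP (learning p eta); last by rewrite value_BHW ?value_ge.
elim: k eta le => //= k IH eta le.
rewrite -NSII_BHW//; apply: ler_sum => a _; rewrite ler_wpM2l ?action_mass_ge0//.
set e := update _ _ _ _; have [/IH//|nl] := boolP (learning p e).
by rewrite value_BHW ?value_ge.
Qed.

(** Strictness travels backwards through an action of positive probability, the other action
    contributing a weak inequality. It is applied where BHW is already worth exactly
    [public_value]. *)
Lemma value_gt_step phi k eta a : 0 < action_mass p eta a (phi eta) ->
  let eta' := update p eta a (phi eta) in
  public_value eta' < value phi k eta' -> public_value eta < value phi k.+1 eta.
Proof.
move=> am /= h; apply: le_lt_trans (public_value_convex eta (phi eta)) _.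
rewrite (bigD1 a)//= [ltRHS](bigD1 a)//= ltr_leD ?ltr_pM2l// ler_sum// => b _.
by rewrite ler_wpM2l ?action_mass_ge0 ?value_ge.
Qed.

(** The same backward step while the two mechanisms still share the belief update. *)
Lemma value_BHW_lt_NSII_step k eta a : learning p eta ->
  0 < action_mass p eta a (NSII p eta) ->
  let eta' := update p eta a (NSII p eta) in
  value (BHW p) k eta' < value (NSII p) k eta' ->
  value (BHW p) k.+1 eta < value (NSII p) k.+1 eta.
Proof.
move=> le am /= h; rewrite -NSII_BHW//.
rewrite (bigD1 a)//= [ltRHS](bigD1 a)//= ltr_leD ?ltr_pM2l// ler_sum// => b _.
by rewrite ler_wpM2l ?action_mass_ge0 ?value_BHW_le_NSII.
Qed.

Lemma thetaNE n m b : @thetaN R n m b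
  = (b == (if n + pm m != 0 then 0 < n + pm m else 0 < n))%:R.
Proof. by []. Qed.

Lemma ell_gt_NSII eta : (1 - p) / p < ell p eta -> NSII p eta = @thetaN R.
Proof.
by move=> h; rewrite /NSII /learning leNgt [_ <= (1 - p) / p]leNgt h andbF.
Qed.

(* Off the learning region with ell large, action -1 forces the next summary to be
   nonpositive, so it overturns the posterior. *)
Lemma value_NSII_gt eta n : (1 - p) / p < ell p eta -> n <= 0 -> 0 < eta n ->
  public_value eta < value (NSII p) 1 eta.
Proof.
move=> h n0 en; rewrite /= big_bool /= !public_value_update ell_gt_NSII//.
rewrite public_value_gtE// -(joint_mass_sum _ (@thetaN R)).
(* Without the split +1 would be chosen throughout. After action +1, keeping to +1 loses nothing;
   the strict gain comes from action -1. *)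
apply: ler_ltD.
  exact: (best_ge (fun w => joint_mass eta (@thetaN R) w true) true).
apply: (@best_gt (fun w => joint_mass eta (@thetaN R) w false)).
  (* Action -1 has positive probability together with W = -1: at the summary n <= 0 a signal -1
     triggers it. *)
  apply: (@avg_gt0 _ _ _ n) => //; first exact: bounded_joint.
    move=> k; rewrite mulr_ge0 ?q_ge0// sumr_ge0// => m _.
    by rewrite mulr_ge0 ?Q_ge0 ?mass_ge0.
  rewrite mulr_gt0 ?q_gt0// (bigD1 false)//= ltr_pwDl//; last first.
    by rewrite sumr_ge0// => m _; rewrite mulr_ge0 ?Q_ge0 ?mass_ge0.
  rewrite mulr_gt0 ?Q_gt0// -[ltRHS]/(@thetaN R n false false).
  rewrite thetaNE [X in _ == X](_ : _ = false) ?eqxx//.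
  by rewrite /pm; case: ifP => _; lia.
(* Pointwise in summary and signal: [thetaN] plays -1 only if their sum is at most 0, where [qQ_le]
   favours W = -1. *)
apply: le_avg => [||k _]; [exact: bounded_joint..|].
rewrite !mulr_sumr ler_sum// => m _; rewrite !mulrA.
rewrite thetaNE; case: eqP => [E|_]; last by rewrite !mulr0.
rewrite !mulr1 (@qQ_le true)//; move: E; rewrite /pm.
by case: ifP => /eqP => h1 /esym/negbT; lia.
Qed.

(** From a summary at least 1, a signal -1 leads at worst to a tie, which is resolved as sign(n) =
    +1. So +1 is certain, while an unseen signal -1 can lower the summary by 1. *)
Lemma NSII_herd eta k j : (1 - p) / p < ell p eta -> 1 <= j ->
  (forall n, eta n != 0 -> j <= n) -> 0 < eta k ->
  let eta' := update p eta true (NSII p eta) in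
  [/\ action_mass p eta true (NSII p eta) = 1, (1 - p) / p < ell p eta',
      forall n, eta' n != 0 -> j - 1 <= n & 0 < eta' (k - 1)].
Proof.
move=> h j1 hj ek /=.
have hc n m : eta n != 0 -> NSII p eta n m true = 1.
  rewrite ell_gt_NSII// thetaNE => /hj jn;
    rewrite (_ : (if _ then _ else _) = true)//.
  by case: ifP => /eqP; case: m; rewrite /pm; lia.
have am := action_mass_certain hc; split => //.
- by rewrite ell_gtE !likelihood_certain// -ell_gtE.
- move=> n; move/update_support; rewrite am oner_eq0 => /(_ isT) [m [/hj]].
  by case: m; rewrite /pm; lia.
- rewrite -[k - 1]/(k + pm false); apply: update_gt0 => //.
    by rewrite am oner_eq0.
  by rewrite hc ?ltr01// gt_eqF.
Qed.

(** Concentration at k is expressed through the support, which spares equalities between [distr]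
    records. *)
Lemma likelihood_supp eta k w : (forall n, eta n != 0 -> n = k) ->
  likelihood eta w = q p w k.
Proof.
move=> h; rewrite /likelihood (@eq_avg _ _ _ (fun _ => q p w k * 1)).
  by rewrite avgZ ?avg1 ?mulr1//; exact: bounded_cst.
by move=> n /h ->; rewrite mulr1.
Qed.

Lemma ell_supp eta k : (forall n, eta n != 0 -> n = k) -> ell p eta = r ^ k.
Proof.
move=> h; rewrite ellE !(likelihood_supp _ h) /q -/r.
have := r_exp_gt0 k; set x := r ^ k => x0; field.
by rewrite gt_eqF// addr_gt0.
Qed.

(** While learning, the action reveals the signal, so a known summary stays known. *)
Lemma NSII_follow eta k : learning p eta ->
  (forall n, eta n != 0 -> n = k) ->
  let eta' := update p eta true (NSII p eta) in
  0 < action_mass p eta true (NSII p eta) /\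
  (forall n, eta' n != 0 -> n = k + 1).
Proof.
move=> le hk /=; have am : 0 < action_mass p eta true (NSII p eta).
  rewrite action_massE (bigD1 true)//= ltr_pwDl ?sumr_ge0//; last first.
    by move=> *; exact: joint_mass_ge0.
  have [n en] := mass_gt0 eta; apply: (avg_gt0 _ _ en).
  - exact: bounded_joint.
  - move=> i; rewrite mulr_ge0 ?q_ge0// sumr_ge0// => m _.
    by rewrite mulr_ge0 ?Q_ge0 ?mass_ge0.
  - rewrite mulr_gt0 ?q_gt0// big_bool /= /NSII le /thetaL !point_massE /=.
    by rewrite mulr1 mulr0 addr0 Q_gt0.
split=> // n; move/update_support; rewrite gt_eqF// => /(_ isT) [m [/hk]].
rewrite /NSII le /thetaL point_massE; case: m; rewrite /pm /= ?eqxx//.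
by move=> <- _; rewrite subrK.
Qed.

(* The belief after t actions +1. *)
Let belief_up t := belief p (NSII p) (fun=> true) t.

Lemma belief_up_support01 n : (belief_up 0 n != 0 -> n = 0) /\ (belief_up 1 n != 0 -> n = 1).
Proof.
have h0 n' : belief_up 0 n' != 0 -> n' = 0.
  by rewrite /belief_up /= /mass /=; have [//|_] := eqVneq n' 0; rewrite eqxx.
split; first exact: h0.
have l0 : learning p (belief_up 0).
  rewrite /learning (ell_supp h0) expr0z -/r (ltW r_gt1) andbT.
  by rewrite ler_pdivrMr ?mul1r; have := p2; lra.
by have [_] := NSII_follow l0 h0; apply.
Qed.

(** The odds are 1 and r. The second lies on the boundary of the region, which is closed, so the
    second action is still informative. *)
Lemma learning_up01 : learning p (belief_up 0) /\ learning p (belief_up 1).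
Proof.
have rV : p / (1 - p) <= 1.
  by rewrite ler_pdivrMr ?mul1r; have := p2; lra.
rewrite /learning (ell_supp (fun n => (belief_up_support01 n).1)).
rewrite (ell_supp (fun n => (belief_up_support01 n).2)) expr0z expr1z -/r.
by rewrite lexx !(ltW r_gt1) rV (le_trans rV (ltW r_gt1)).
Qed.

Lemma belief_up2 :
  (1 - p) / p < ell p (belief_up 2) /\ (forall n, belief_up 2 n != 0 -> n = 2).
Proof.
have [_ l1] := learning_up01.
have [_ h2] := NSII_follow l1 (fun n => (belief_up_support01 n).2).
split; last exact: h2.
by rewrite (ell_supp h2) -/r -[X in X < _]expr1z ltr_eXz2l.
Qed.

Lemma belief_up34 : [/\ action_mass p (belief_up 2) true (NSII p (belief_up 2)) = 1,
  action_mass p (belief_up 3) true (NSII p (belief_up 3)) = 1,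
  (1 - p) / p < ell p (belief_up 4) & 0 < belief_up 4 0].
Proof.
have [e2 h2] := belief_up2.
have g2 : 0 < belief_up 2 2.
  have [n en] := mass_gt0 (belief_up 2); have := en.
  by rewrite {1}(h2 n)// gt_eqF.
have h2' n : belief_up 2 n != 0 -> 2 <= n by move/h2 ->.
have [a2 e3 h3 g3] := NSII_herd e2 (isT : 1 <= 2 :> int) h2' g2.
have [a3 e4 h4 g4] := NSII_herd e3 (isT : 1 <= 2 - 1 :> int) h3 g3.
by split.
Qed.

Lemma action_mass_up t : (t < 4)%N ->
  0 < action_mass p (belief_up t) true (NSII p (belief_up t)).
Proof.
have [l0 l1] := learning_up01; have [a2 a3 _ _] := belief_up34.
case: t => [|[|[|[|//]]]] _.
- by have [] := NSII_follow l0 (fun n => (belief_up_support01 n).1).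
- by have [] := NSII_follow l1 (fun n => (belief_up_support01 n).2).
- by rewrite a2.
- by rewrite a3.
Qed.

(** The horizon 5 consists of two learning steps, two herding steps and the split of
    [value_NSII_gt]. *)
Lemma value5_BHW_lt_NSII :
  value (BHW p) 5 (point_mass 0) < value (NSII p) 5 (point_mass 0).
Proof.
have [l0 l1] := learning_up01; have [e2 _] := belief_up2.
have [a2 a3 e4 g4] := belief_up34.
apply: (@value_BHW_lt_NSII_step 4 (belief_up 0) true l0
  (action_mass_up (isT : (0 < 4)%N))).
apply: (@value_BHW_lt_NSII_step 3 (belief_up 1) true l1
  (action_mass_up (isT : (1 < 4)%N))).
rewrite -[update _ _ _ _]/(belief_up 2).
(* BHW is frozen from here on; NSII has three periods left to exceed [public_value]. *)
rewrite value_BHW; last first.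
  by rewrite /learning [_ <= (1 - p) / p]leNgt e2 andbF.
apply: (@value_gt_step _ 2 (belief_up 2) true
  (action_mass_up (isT : (2 < 4)%N))).
apply: (@value_gt_step _ 1 (belief_up 3) true
  (action_mass_up (isT : (3 < 4)%N))).
exact: (value_NSII_gt e4 (lexx 0) g4).
Qed.

Lemma expected_utilityE eta theta : expected_utility p eta theta =
  avg eta (fun n => \sum_(y : bool) \sum_(w : bool)
    Q p y w * q p w n * theta n y w).
Proof.
rewrite avg_bool => [|y]; last by bounded_tac.
apply: eq_bigr => y _; rewrite avg_bool => [|w]; last by bounded_tac.
by apply: eq_bigr => w _; congr zsum; apply/funext => n; ring.
Qed.

Lemma expected_utility_joint eta theta :
  expected_utility p eta theta = \sum_(w : bool) joint_mass eta theta w w.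
Proof.
rewrite expected_utilityE /joint_mass -avg_bool => [|w]; last by bounded_tac.
apply: eq_avg => n _; rewrite exchange_big /=; apply: eq_bigr => w _.
by rewrite mulr_sumr; apply: eq_bigr => y _; ring.
Qed.

(** * Taxes, truth-telling and the outside option *)

Section Taxation.
Variable gamma : distr R int -> bool -> distr R bool.
Hypothesis hgamma : optimal_nonjoining p gamma.

Lemma taxE eta theta : tax p gamma eta theta =
  avg eta (fun n => \sum_(y : bool) \sum_(w : bool)
    Q p y w * q p w n * (theta n y w - gamma eta y w)).
Proof.
rewrite avg_bool => [|y]; last by bounded_tac.
apply: eq_bigr => y _; rewrite avg_bool => [|w]; last by bounded_tac.
by apply: eq_bigr => w _; congr zsum; apply/funext => n; ring.
Qed.

Lemma tax_utility eta theta : tax p gamma eta theta =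
  expected_utility p eta theta - expected_utility p eta (fun _ y => gamma eta y).
Proof.
rewrite taxE !expected_utilityE -avgB; [|by bounded_tac..].
by apply: eq_avg => n _; rewrite !big_bool /=; ring.
Qed.

Lemma nonjoining_optimal eta y :
  \sum_(w : bool) Q p y w * likelihood eta w * gamma eta y w =
  Num.max (Q p y true * likelihood eta true) (Q p y false * likelihood eta false).
Proof.
have g1 := mass_bool (gamma eta y).
have ht : gamma eta y true != 0 ->
    Q p y false * likelihood eta false <= Q p y true * likelihood eta true.
  by move=> h; exact: (hgamma h).
have hf : gamma eta y false != 0 ->
    Q p y true * likelihood eta true <= Q p y false * likelihood eta false.
  by move=> h; exact: (hgamma h).
rewrite big_bool /=.
have [g0|gt] := eqVneq (gamma eta y true) 0.
  move: g1 hf; rewrite g0 add0r => ->; rewrite oner_eq0 mulr0 add0r mulr1.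
  by move=> /(_ isT) /max_r.
have -> : gamma eta y false = 1 - gamma eta y true by rewrite -g1 addrAC subrr add0r.
rewrite max_l ?ht//.
have [g0|gf] := eqVneq (gamma eta y false) 0.
  by move: g1; rewrite g0 addr0 => ->; rewrite subrr mulr0 addr0 mulr1.
(* If [gamma] mixes, both actions are optimal and their payoffs agree, so tie-breaking does not
   affect the value. *)
by have /eqP := le_anti (introT andP (conj (ht gt) (hf gf))) => /eqP ->; ring.
Qed.

Lemma nonjoining_utility eta :
  expected_utility p eta (fun _ y => gamma eta y) = public_value eta.
Proof.
rewrite expected_utilityE avg_bool => [|y]; last by bounded_tac.
apply: eq_bigr => y _; rewrite -nonjoining_optimal.
rewrite avg_bool => [|w]; last by bounded_tac.
apply: eq_bigr => w _; rewrite mulrAC /likelihood -avgZ; last by bounded_tac.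
by apply: eq_avg => n _; ring.
Qed.

Lemma individually_rational_all phi : individually_rational p gamma phi.
Proof. by move=> eta; rewrite tax_utility opprB addrC subrK. Qed.

(** A crude uniform bound, one unit for each pair (y, w), from which the dominating constant for
    discounted welfare is built. *)
Lemma tax_bound eta theta : `|tax p gamma eta theta| <= 4.
Proof.
have [[h1 h2] [h3 h4]] : (0 <= expected_utility p eta theta /\
    expected_utility p eta theta <= 4) /\
    (0 <= expected_utility p eta (fun _ y => gamma eta y) /\
    expected_utility p eta (fun _ y => gamma eta y) <= 4).
  suff H th : 0 <= expected_utility p eta th /\ expected_utility p eta th <= 4.
    by split.
  rewrite expected_utilityE; split.
    apply: avg_ge0 => n; apply: sumr_ge0 => y _; apply: sumr_ge0 => w _.
    by rewrite mulr_ge0 ?mass_ge0// mulr_ge0 ?Q_ge0 ?q_ge0.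
  have -> : 4 = avg eta (fun=> 4 * 1 : R).
    by rewrite avgZ ?avg1 ?mulr1//; exact: bounded_cst.
  apply: le_avg; [by bounded_tac..|] => n _.
  have le1 y w : Q p y w * q p w n * th n y w <= 1.
    have /andP[Q0 Q1] := Q_itv y w p01; have /andP[q0 q1] := q_itv w n p01.
    exact: (mulr_ile1 (mulr_ge0 Q0 q0) (mass_ge0 _ _) (mulr_ile1 Q0 q0 Q1 q1)
      (mass_le1 _ _)).
  have := le1 true true; have := le1 true false.
  have := le1 false true; have := le1 false false.
  by rewrite !big_bool /=; lra.
by rewrite tax_utility ler_norml; apply/andP; split; lra.
Qed.

(** Given both n and y, [thetaN] plays a maximizer of the posterior, hence does at least as well as
    any lottery [d]. With [gamma] as [d] this yields nonnegative taxes; with the recommendation for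
    the opposite signal, truth-telling. *)
Lemma thetaN_optimal n y (d : distr R bool) :
  0 <= \sum_(w : bool) Q p y w * q p w n * (@thetaN R n y w - d w).
Proof.
have d1 := mass_bool d; have dt := mass_ge0 d true; have df := mass_ge0 d false.
have h b : (if b then n + pm y <= 0 else 0 <= n + pm y) ->
   q p b n * Q p y b <= q p (~~ b) n * Q p y (~~ b) by exact: qQ_le.
rewrite big_bool !thetaNE /=.
have := h true; have := h false => /= {h}.
case: (ltgtP (n + pm y) 0) => [lt|gt|eq] /= h0 h1.
- by move: (h1 isT) => h; nra.
- by move: (h0 isT) => h; nra.
(* At n + m = 0 the two states are equally likely, so either resolution of the tie is optimal. *)
- by move: (h0 isT) (h1 isT) => h h'; case: (0 < n) => /=; nra.
Qed.

(** The counterpart of [thetaN_optimal] inside the region, after averaging over n: the public odds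
    are too weak to outweigh one's own signal. *)
Lemma learning_optimal eta y (d : distr R bool) : learning p eta ->
  0 <= \sum_(w : bool) Q p y w * likelihood eta w * ((w == y)%:R - d w).
Proof.
rewrite learningE => /andP[h1 h2].
have d1 := mass_bool d; have dt := mass_ge0 d true; have df := mass_ge0 d false.
by rewrite big_bool /=; case: y; rewrite /Q /=; nra.
Qed.

Lemma nonnegative_tax_NSII : nonnegative_tax p gamma (NSII p).
Proof.
move=> eta; rewrite /NSII; case: ifPn => le; last first.
  rewrite taxE; apply: avg_ge0 => n; apply: sumr_ge0 => y _.
  exact: thetaN_optimal.
rewrite /tax; apply: sumr_ge0 => y _.
apply: le_trans (learning_optimal y (gamma eta y) le) _.
rewrite le_eqVlt; apply/orP; left; apply/eqP; apply: eq_bigr => w _.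
rewrite mulrAC /likelihood -avgZ; last by bounded_tac.
by congr zsum; apply/funext => n; rewrite /thetaL point_massE; ring.
Qed.

Lemma truth_telling_NSII : truth_telling p (NSII p).
Proof.
move=> eta y; rewrite /NSII; case: ifPn => le; last first.
  have -> : \sum_(w : bool) zsum (fun n => Q p y w * eta n * q p w n *
      (@thetaN R n y w - @thetaN R n (~~ y) w))
    = avg eta (fun n => \sum_(w : bool) Q p y w * q p w n *
      (@thetaN R n y w - @thetaN R n (~~ y) w)).
    rewrite avg_bool => [|w]; last by bounded_tac.
    by apply: eq_bigr => w _; congr zsum; apply/funext => n; ring.
  by apply: avg_ge0 => n; exact: thetaN_optimal.
apply: le_trans (learning_optimal y (point_mass (~~ y)) le) _.
rewrite le_eqVlt; apply/orP; left; apply/eqP; apply: eq_bigr => w _.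
rewrite mulrAC /likelihood -avgZ; last by bounded_tac.
by congr zsum; apply/funext => n; rewrite /thetaL !point_massE; ring.
Qed.

(** An agent with signal -1 would play +1 on her own, yet at summary 0 [thetaN] tells her -1. The
    information is worth (1 - 2p)/2 there and never has negative value elsewhere. *)
Lemma tax_NSII_gt0 eta : (1 - p) / p < ell p eta -> 0 < eta 0 ->
  0 < tax p gamma eta (NSII p eta).
Proof.
move=> h e0; rewrite taxE ell_gt_NSII//.
have gt : gamma eta false true = 1.
  have := mass_bool (gamma eta false).
  suff -> : gamma eta false false = 0 by rewrite addr0.
  apply/eqP/negPn/negP => /hgamma /(_ true); apply/negP; rewrite -ltNge.
  by move: h; rewrite ell_gtE.
apply: (avg_gt0 _ _ e0); first by bounded_tac.
  by move=> n; apply: sumr_ge0 => y _; exact: thetaN_optimal.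
rewrite (bigD1 false)// ltr_pwDl//; last first.
  by apply: sumr_ge0 => y _; exact: thetaN_optimal.
have gf : gamma eta false false = 0.
  by have := mass_bool (gamma eta false); rewrite gt; lra.
have [nt nf] : @thetaN R 0 false true = 0 /\ @thetaN R 0 false false = 1 by [].
rewrite big_bool gt gf nt nf /q expr0z /Q /= div1r.
by have := p2; rewrite -[1 + 1]/(2%:R : R); lra.
Qed.

End Taxation.

End Beliefs.

(** * The law of a realization along action histories *)

Section Paths.
Context {R : realType}.
Variables (p : R) (hp : 0 < p < 2^-1) (phi : @mechanism R) (X : process p phi).

Local Notation P := (prob X).

Let probU (A B : set (sample X)) : measurable A -> measurable B ->
  A `&` B = set0 -> P (A `|` B) = (P A + P B)%E.
Proof. exact: measureU. Qed.

(** Extends a history of length t by one entry; histories are total functions of which only an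
    initial segment is read. *)
Definition set_bit (a : nat -> bool) t b : nat -> bool :=
  fun s => if s == t then b else a s.

Lemma set_bit_lt a t b s : (s < t)%N -> set_bit a t b s = a s.
Proof. by rewrite /set_bit ltn_neqAle => /andP[/negPf ->]. Qed.

Lemma set_bit_eq a t b : set_bit a t b t = b.
Proof. by rewrite /set_bit eqxx. Qed.

Lemma set_bitP (f a : nat -> bool) t b :
  (forall s, (s < t.+1)%N -> f s = set_bit a t b s) <->
  ((forall s, (s < t)%N -> f s = a s) /\ f t = b).
Proof.
split=> [h|[h1 h2] s].
  split=> [s st|]; last by rewrite h// set_bit_eq.
  by rewrite h ?set_bit_lt// ltnS ltnW.
rewrite ltnS leq_eqVlt => /predU1P[->|st]; first by rewrite set_bit_eq.
by rewrite set_bit_lt// h1.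
Qed.

Lemma eq_belief a b t : (forall s, (s < t)%N -> a s = b s) ->
  belief p phi a t = belief p phi b t.
Proof.
elim: t => //= t IH ab.
by rewrite IH ?ab// => s st; apply: ab; rewrite ltnS ltnW.
Qed.

Lemma belief_set_bit a t b : belief p phi (set_bit a t b) t = belief p phi a t.
Proof. by apply: eq_belief => s; exact: set_bit_lt. Qed.

Lemma beliefS_set_bit a t b : belief p phi (set_bit a t b) t.+1
  = update p (belief p phi a t) b (phi (belief p phi a t)).
Proof. by rewrite /= belief_set_bit set_bit_eq. Qed.

Lemma summary_set_bit y t b :
  summary (set_bit y t b) t.+1 = summary y t + pm b.
Proof.
rewrite /summary big_ord_recr /= set_bit_eq; congr (_ + _).
by apply: eq_bigr => i _; rewrite set_bit_lt.
Qed.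

Lemma measurable_bit (Z : {RV P >-> bool}) b : measurable [set x | Z x = b].
Proof.
have := measurable_funP Z measurableT [set b] I.
by rewrite setTI; congr measurable; apply/seteqP; split.
Qed.

Lemma measurable_bits (Z : nat -> {RV P >-> bool}) (a : nat -> bool) t :
  measurable [set x | forall s, (s < t)%N -> Z s x = a s].
Proof.
have -> : [set x | forall s, (s < t)%N -> Z s x = a s]
    = \bigcap_(s in [set s | (s < t)%N]) [set x | Z s x = a s].
  by apply/seteqP; split=> x /= h s; apply: h.
apply: fin_bigcap_measurable => [|s _]; last exact: measurable_bit.
exact: finite_II.
Qed.

Definition actions_are (a : nat -> bool) t : set (sample X) :=
  [set x | forall s, (s < t)%N -> action X s x = a s].

Lemma measurable_actions a t : measurable (actions_are a t).
Proof. exact: measurable_bits. Qed.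

Lemma actions_are0 a : actions_are a 0 = setT.
Proof. by apply/seteqP; split. Qed.

Lemma actions_areS a t : actions_are a t =
  actions_are (set_bit a t true) t.+1 `|` actions_are (set_bit a t false) t.+1.
Proof.
apply/seteqP; split=> [x h|x [] /set_bitP[]//].
by have [ht|hf] := boolP (action X t x); [left|right]; apply/set_bitP;
  split=> //; exact/negbTE.
Qed.

Lemma actions_are_disjoint a t :
  [disjoint actions_are (set_bit a t true) t.+1
          & actions_are (set_bit a t false) t.+1].
Proof.
apply/disj_setPS => x [/set_bitP[_ h1] /set_bitP[_ h2]].
by move: h1; rewrite h2.
Qed.

(** Separate horizons for signals and actions interpolate between the cylinders of [process_law] (t
    = u) and events where all signals are summed out (t = 0). *)
Definition path_event (w : bool) (y a : nat -> bool) t u : set (sample X) :=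
  [set x | state X x = w] `&` [set x | forall s, (s < t)%N -> signal X s x = y s]
    `&` actions_are a u.

Lemma measurable_path_event w y a t u : measurable (path_event w y a t u).
Proof.
by apply: measurableI; [apply: measurableI; [exact: measurable_bit|
  exact: measurable_bits]|exact: measurable_actions].
Qed.

(* Given W = w, the probability that the agents s, ..., s + k - 1 act as in
   [a] when the summary at s is n. *)
Fixpoint future_weight (w : bool) (a : nat -> bool) k s (n : int) : R :=
  if k is j.+1 then
    \sum_(m : bool) Q p m w * phi (belief p phi a s) n m (a s)
                    * future_weight w a j s.+1 (n + pm m)
  else 1.

(** Induction on k with t and y free: splitting on the signal of agent t gives two instances at
    [t.+1]. *)
Lemma path_event_prob w y a t k : P (path_event w y a t (t + k)) =
  (2^-1 * \prod_(s < t)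
      (Q p (y s) w * phi (belief p phi a s) (summary y s) (y s) (a s))
    * future_weight w a k t (summary y t))%:E.
Proof.
elim: k t y => [|k IH] t y.
  rewrite addn0 mulr1 -(@process_law _ _ _ X); congr (P _); apply/seteqP; split => x /=.
    by move=> [[xw xy] xa]; split=> // s st; split; [exact: xy|exact: xa].
  by move=> [xw xya]; split; [split=> //|] => s /xya[].
have -> : path_event w y a t (t + k.+1) =
    path_event w (set_bit y t true) a t.+1 (t.+1 + k) `|`
    path_event w (set_bit y t false) a t.+1 (t.+1 + k).
  rewrite addSnnS; apply/seteqP; split=> x.
    move=> [[xw xy] xa]; have [ht|hf] := boolP (signal X t x).
      by left; split=> //; split=> //; apply/set_bitP.
    by right; split=> //; split=> //; apply/set_bitP; split=> //; exact/negbTE.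
  by case=> -[[xw /set_bitP[xy _]] xa]; split.
rewrite probU; [|exact: measurable_path_event..|]; last first.
  apply/seteqP; split=> // x [[[_ /set_bitP[_ h1]] _] [[_ /set_bitP[_ h2]] _]].
  by move: h1; rewrite h2.
rewrite !IH -EFinD; congr EFin; rewrite !summary_set_bit /= big_bool /=.
rewrite !big_ord_recr /= !set_bit_eq.
have E b : \prod_(i < t) (Q p (set_bit y t b i) w * phi (belief p phi a i)
      (summary (set_bit y t b) i) (set_bit y t b i) (a i)) =
    \prod_(i < t) (Q p (y i) w * phi (belief p phi a i) (summary y i) (y i) (a i)).
  apply: eq_bigr => i _; rewrite set_bit_lt//; congr (_ * phi _ _ _ _).
  apply: eq_bigr => j _; rewrite set_bit_lt//.
  exact: ltn_trans (ltn_ord j) (ltn_ord i).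
have S b : summary (set_bit y t b) t = summary y t.
  by apply: eq_bigr => j _; rewrite set_bit_lt.
by rewrite !E !S; ring.
Qed.

Lemma future_weight_ge0 w a k s n : 0 <= future_weight w a k s n.
Proof.
elim: k s n => //= k IH s n; apply: sumr_ge0 => m _.
by rewrite mulr_ge0 ?IH// mulr_ge0 ?mass_ge0 ?Q_ge0.
Qed.

Lemma bounded_future_weight w a k s : bounded (future_weight w a k s).
Proof.
elim: k s => [|k IH] s; first exact: bounded_cst.
rewrite /=; bounded_tac; exact: IH.
Qed.

Definition path_weight (a : nat -> bool) t : R :=
  \prod_(s < t) action_mass p (belief p phi a s) (a s) (phi (belief p phi a s)).

(** Connects Bayesian updating with the law of the process: each step of [future_weight] is one use
    of [update_avg], which brings out the probability of the next action. *)
Lemma future_weight_avg w a k s :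
  avg (belief p phi a s) (fun n => q p w n * future_weight w a k s n) =
  (\prod_(i < k) action_mass p (belief p phi a (s + i)) (a (s + i)%N)
                   (phi (belief p phi a (s + i))))
  * likelihood p (belief p phi a (s + k)) w.
Proof.
elim: k s => [|k IH] s.
  rewrite big_ord0 mul1r addn0; apply: eq_avg => n _ /=.
  by rewrite mulr1.
rewrite big_ord_recl /= addn0 -mulrA -addSnnS.
rewrite (update_avg hp); [|exact: future_weight_ge0|exact: bounded_future_weight].
rewrite -[update _ _ _ _]/(belief p phi a s.+1) IH; congr (_ * (_ * _)).
by apply: eq_bigr => i _; rewrite [bump _ _]add1n addSnnS.
Qed.

Lemma state_actions_prob w a t :
  P ([set x | state X x = w] `&` actions_are a t) =
  (path_weight a t * likelihood p (belief p phi a t) w)%:E.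
Proof.
have := path_event_prob w a a 0 t.
have -> : path_event w a a 0 (0 + t) = [set x | state X x = w] `&` actions_are a t.
  by apply/seteqP; split=> x [] // [].
move=> ->; have /= <- := future_weight_avg w a t 0.
(* The initial belief evaluates at summary 0, and q(w | 0) = 1/2 is the prior of W. *)
rewrite avg_point big_ord0 mulr1 /summary big_ord0; congr (_ * _)%:E.
by rewrite /q expr0z; case: w; rewrite div1r.
Qed.

Lemma actions_prob a t : P (actions_are a t) = (path_weight a t)%:E.
Proof.
have -> : actions_are a t = ([set x | state X x = true] `&` actions_are a t)
    `|` ([set x | state X x = false] `&` actions_are a t).
  apply/seteqP; split=> [x h|x [] []//].
  by have [ht|hf] := boolP (state X x); [left|right]; split=> //; exact/negbTE.
rewrite probU; [|by apply: measurableI;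
  [exact: measurable_bit|exact: measurable_actions]..|]; last first.
  by apply/seteqP; split=> // x [[/= h1 _] [/= h2 _]]; move: h1; rewrite h2.
rewrite 2!state_actions_prob -EFinD -mulrDr.
by rewrite (likelihood_sum hp) mulr1.
Qed.

Lemma path_weightS a t b : path_weight (set_bit a t b) t.+1 = path_weight a t *
  action_mass p (belief p phi a t) b (phi (belief p phi a t)).
Proof.
rewrite /path_weight big_ord_recr /= belief_set_bit set_bit_eq; congr (_ * _).
apply: eq_bigr => i _; rewrite set_bit_lt//.
rewrite (@eq_belief _ a)// => s si; rewrite set_bit_lt//.
exact: ltn_trans si (ltn_ord i).
Qed.

Lemma correct_prob a t :
  P ([set x | action X t x = state X x] `&` actions_are a t) =
  (path_weight a t * expected_utility p (belief p phi a t)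
                       (phi (belief p phi a t)))%:E.
Proof.
have -> : [set x | action X t x = state X x] `&` actions_are a t =
    ([set x | state X x = true] `&` actions_are (set_bit a t true) t.+1)
    `|` ([set x | state X x = false] `&` actions_are (set_bit a t false) t.+1).
  apply/seteqP; split=> x.
    move=> [/= h1 h2]; have [ht|/negbTE hf] := boolP (state X x); [left|right];
    by split=> //; apply/set_bitP; split=> //; rewrite h1.
  by case=> -[/= h1 /set_bitP[h2 h3]]; split=> //=; rewrite h3.
rewrite probU; [|by apply: measurableI;
  [exact: measurable_bit|exact: measurable_actions]..|]; last first.
  by apply/seteqP; split=> // x [[/= h1 _] [/= h2 _]]; move: h1; rewrite h2.
rewrite 2!state_actions_prob -EFinD 2!path_weightS 2!beliefS_set_bit.
rewrite -2!mulrA 2!(likelihood_update hp) -mulrDr (expected_utility_joint hp).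
by rewrite big_bool.
Qed.

Lemma public_belief_actions a t x : actions_are a t x ->
  public_belief t x = belief p phi a t.
Proof. by move=> h; exact: eq_belief. Qed.

(** Any function of the belief is constant on each of the finitely many cells of action histories.
    The induction refines a cell of length s until its length is s + k, so beliefs themselves carry
    no measurable structure. *)
Lemma measurable_public_belief (G : distr R int -> R) t :
  measurable_fun [set: sample X] (fun x => G (public_belief t x)).
Proof.
suff H k s a : measurable_fun (actions_are a s) (fun x => G (public_belief (s + k) x)).
  by have := H t 0%N xpredT; rewrite actions_are0.
elim: k s a => [|k IH] s a.
  apply: (eq_measurable_fun (cst (G (belief p phi a s)))); last exact: measurable_cst.
  by move=> x; rewrite inE addn0 => /public_belief_actions ->.
rewrite actions_areS measurable_funU; [|exact: measurable_actions..].
by rewrite addnS -addSn; split; exact: IH.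
Qed.

(** * Expected net utility, discounted welfare and revenue *)

Section Payoffs.
Variable gamma : distr R int -> bool -> distr R bool.
Hypothesis hgamma : optimal_nonjoining p gamma.

Lemma measurable_paid_tax t : measurable_fun setT (paid_tax gamma X t).
Proof. exact: (measurable_public_belief (fun e => tax p gamma e (phi e))). Qed.

Lemma utility_indic t : utility X t = \1_[set x | action X t x = state X x].
Proof.
apply/funext => x; rewrite /utility indicE.
by case: eqP => h; [rewrite mem_set|rewrite memNset].
Qed.

Lemma measurable_correct t : measurable [set x | action X t x = state X x].
Proof.
have -> : [set x | action X t x = state X x] =
    ([set x | action X t x = true] `&` [set x | state X x = true]) `|`
    ([set x | action X t x = false] `&` [set x | state X x = false]).
  apply/seteqP; split=> x /=; last by case=> -[-> ->].
  by move=> ->; case: (state X x); [left|right].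
by apply: measurableU; apply: measurableI; exact: measurable_bit.
Qed.

Lemma measurable_net_utility t : measurable_fun setT (net_utility gamma X t).
Proof.
apply: measurable_funB; last exact: measurable_paid_tax.
rewrite utility_indic; exact: measurable_indic (measurable_correct t).
Qed.

Lemma net_utility_bound t x : `|net_utility gamma X t x| <= 5.
Proof.
have := tax_bound hp gamma (public_belief t x) (phi (public_belief t x)).
rewrite -/(paid_tax gamma X t x) /net_utility => h.
apply: le_trans (ler_normB _ _) _; rewrite /utility.
have : `|((action X t x == state X x)%:R : R)| <= 1.
  by case: (_ == _); rewrite ?normr1 ?normr0.
by move: h; set u := `|_|; set v := `|_|; lra.
Qed.

(** Identifies the process with the recursion [value], by refining the history one action at a
    time. *)
Lemma net_utility_integral a s k :
  (\int[P]_(x in actions_are a s) (net_utility gamma X (s + k) x)%:E)%E =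
  (path_weight a s * value p phi k (belief p phi a s))%:E.
Proof.
elim: k s a => [|k IH] s a; last first.
  rewrite actions_areS integral_setU; [|exact: measurable_actions..| |
    exact: actions_are_disjoint]; last first.
    apply/measurable_EFinP; apply: measurable_funS (measurable_net_utility _) => //.
  rewrite addnS -addSn !IH -EFinD; congr EFin.
  by rewrite !path_weightS !beliefS_set_bit /= big_bool /= -!mulrA -mulrDr.
rewrite addn0; set c := tax p gamma (belief p phi a s) (phi (belief p phi a s)).
have mD := measurable_actions a s.
transitivity (\int[P]_(x in actions_are a s)
    ((\1_[set x | action X s x = state X x] x)%:E - (cst c x)%:E))%E.
  apply: eq_integral => x; rewrite inE => h; rewrite -EFinB; congr EFin.
  by rewrite /net_utility utility_indic /paid_tax (public_belief_actions h).
rewrite integralB_EFin//; last exact: finite_measure_integrable_cst.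
  rewrite integral_indic//; last exact: measurable_correct.
  have -> : (\int[P]_(x in actions_are a s) (cst c x)%:E = c%:E * P (actions_are a s))%E.
    exact: (integral_cst P mD c%:E).
  rewrite [X in (X - _)%E]correct_prob actions_prob -EFinM -EFinB; congr EFin.
  (* The tax removes all utility above the outside option, which leaves [public_value]. *)
  rewrite /c (tax_utility hp) (nonjoining_utility hp hgamma) /=.
  by rewrite [_ * path_weight _ _]mulrC -mulrBr opprB addrC subrK.
apply: (@integrableS _ _ _ _ setT) => //.
exact: integrable_indic (measurable_correct s).
Qed.

Lemma path_weight0 a : path_weight a 0 = 1.
Proof. by rewrite /path_weight big_ord0. Qed.

Lemma expected_net_utility t :
  ('E_P[net_utility gamma X t] = (value p phi t (point_mass 0))%:E)%E.
Proof.
rewrite unlock; have := net_utility_integral xpredT 0 t.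
by rewrite actions_are0 add0n path_weight0 mul1r.
Qed.

Lemma net_utility_integrable t :
  P.-integrable setT (EFin \o net_utility gamma X t).
Proof.
apply: measurable_bounded_integrable => //.
- by rewrite [X in (X < _)%E]probability_setT ltry.
- exact: measurable_net_utility.
- by exists 5; split=> // M hM x _; exact: le_trans (net_utility_bound t x) (ltW hM).
Qed.

Lemma discounted_bound delta n x : 0 < delta < 1 ->
  `|series (fun t => delta ^+ t * net_utility gamma X t x) n| <= 5 / (1 - delta).
Proof.
move=> /andP[d0 d1]; rewrite /series /=; apply: le_trans (ler_norm_sum _ _ _) _.
apply: (@le_trans _ _ (series (geometric 5 delta) n)).
  apply: ler_sum => t _; rewrite normrM ger0_norm ?exprn_ge0 ?(ltW d0)// mulrC /=.
  by rewrite ler_wpM2r ?exprn_ge0 ?net_utility_bound ?(ltW d0).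
by apply: geometric_le_lim => //; rewrite gtr0_norm.
Qed.

Lemma discounted_cvg delta x : 0 < delta < 1 ->
  series (fun t => delta ^+ t * net_utility gamma X t x) @ \oo --> NSW gamma X delta x.
Proof.
move=> /andP[d0 d1].
suff : cvgn (series (fun t => delta ^+ t * net_utility gamma X t x)) by [].
apply: normed_cvg.
apply: (@series_le_cvg _ _ (geometric 5 delta)) => [t|t|t|].
- exact: normr_ge0.
- by rewrite /= mulr_ge0// exprn_ge0// (ltW d0).
- rewrite /= normrM ger0_norm ?exprn_ge0 ?(ltW d0)// mulrC.
  by rewrite ler_wpM2r ?exprn_ge0 ?net_utility_bound ?(ltW d0).
- by apply: is_cvg_geometric_series; rewrite gtr0_norm.
Qed.

(** Dominated convergence exchanges expectation and limit, the partial sums being at most 5 / (1 -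
    delta) in absolute value. Finiteness is recorded because [fine] would hide an infinite value. *)
Lemma expected_NSW delta : 0 < delta < 1 ->
  ('E_P[NSW gamma X delta])%E \is a fin_num /\
  series (fun t => delta ^+ t * value p phi t (point_mass 0)) @ \oo
    --> fine ('E_P[NSW gamma X delta])%E.
Proof.
move=> hd; have /andP[d0 d1] := hd.
pose f n x := (series (fun t => delta ^+ t * net_utility gamma X t x) n)%:E.
have mser n : measurable_fun setT
    (fun x => series (fun t => delta ^+ t * net_utility gamma X t x) n).
  apply: measurable_sum => t; apply: measurable_funM => //.
  exact: measurable_net_utility.
have mf n : measurable_fun setT (f n) by apply/measurable_EFinP.
have mN : measurable_fun setT (EFin \o NSW gamma X delta).
  apply/measurable_EFinP; apply: (measurable_fun_cvg mser) => x _.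
  exact: discounted_cvg.
have cf : {ae P, forall x, setT x -> f ^~ x @ \oo --> (NSW gamma X delta x)%:E}.
  apply: aeW => x _; apply: cvg_EFin; last exact: discounted_cvg.
  by apply: nearW => n.
have ig : P.-integrable setT (EFin \o cst (5 / (1 - delta))).
  exact: finite_measure_integrable_cst.
have fg : {ae P, forall x n, setT x -> (`|f n x| <= (EFin \o cst (5 / (1 - delta))%R) x)%E}.
  by apply: aeW => x n _; rewrite lee_fin discounted_bound.
have [iN _ lim] := dominated_convergence measurableT mf mN cf ig fg.
have fin : ('E_P[NSW gamma X delta])%E \is a fin_num.
  by rewrite unlock; exact: integrable_fin_num iN.
split=> //; rewrite unlock in fin *.
have -> : series (fun t => delta ^+ t * value p phi t (point_mass 0)) =
    fine \o (fun n => \int[P]_x f n x)%E.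
  apply/funext => n /=; rewrite /f /series /=.
  under eq_integral do rewrite -sumEFin.
  rewrite integral_sum// => [|t]; last first.
    under eq_fun do rewrite EFinM.
    by apply: integrableZl => //; exact: net_utility_integrable.
  apply: EFin_inj; rewrite fineK; last first.
    apply/sum_fin_numP => t _ _.
    under eq_integral do rewrite EFinM.
    rewrite integralZl//; last exact: net_utility_integrable.
    by have := expected_net_utility t; rewrite unlock => ->.
  rewrite -sumEFin; apply: eq_bigr => t _.
  under eq_integral do rewrite EFinM.
  rewrite integralZl//; last exact: net_utility_integrable.
  by have := expected_net_utility t; rewrite unlock => ->.
by apply: fine_cvg; rewrite fineK.
Qed.

Lemma paid_tax_integral a t :
  (\int[P]_(x in actions_are a t) (paid_tax gamma X t x)%:E)%E =
  (path_weight a t * tax p gamma (belief p phi a t) (phi (belief p phi a t)))%:E.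
Proof.
set c := tax _ _ _ _.
transitivity (\int[P]_(x in actions_are a t) cst c%:E x)%E.
  apply: eq_integral => x; rewrite inE => h.
  by rewrite /paid_tax (public_belief_actions h).
transitivity (c%:E * P (actions_are a t))%E.
  exact: (integral_cst P (measurable_actions a t) c%:E).
by rewrite actions_prob -EFinM mulrC.
Qed.

(** Nonnegative taxes allow termwise integration of the possibly infinite sum, which then dominates
    the tax of a single agent after a single history. *)
Lemma revenue_gt0 a t : nonnegative_tax p gamma phi -> 0 < path_weight a t ->
  0 < tax p gamma (belief p phi a t) (phi (belief p phi a t)) ->
  (0 < \int[P]_x revenue gamma X x)%E.
Proof.
move=> tax0 w0 c0.
have mt s : measurable_fun setT (fun x => (paid_tax gamma X s x)%:E).
  by apply/measurable_EFinP; exact: measurable_paid_tax.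
have t0 s x : (0 <= (paid_tax gamma X s x)%:E)%E by rewrite lee_fin; exact: tax0.
rewrite /revenue integral_nneseries//.
apply: (@lt_le_trans _ _ (\sum_(0 <= s < t.+1) \int[P]_x (paid_tax gamma X s x)%:E)%E);
  last by apply: nneseries_lim_ge => s _ _; exact: integral_ge0.
rewrite big_nat_recr//=; apply: (@lt_le_trans _ _ (\int[P]_x (paid_tax gamma X t x)%:E)%E).
  apply: (@lt_le_trans _ _ (\int[P]_(x in actions_are a t) (paid_tax gamma X t x)%:E)%E).
    by rewrite paid_tax_integral lte_fin mulr_gt0.
  by apply: ge0_subset_integral => //; exact: measurable_actions.
by rewrite leeDr// sume_ge0// => s _; exact: integral_ge0.
Qed.

End Payoffs.
End Paths.

Theorem theorem4 (R : realType) (p delta : R)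
    (hp : 0 < p < 2^-1) (hdelta : 0 < delta < 1)
    (gamma : distr R int -> bool -> distr R bool)
    (hgamma : optimal_nonjoining p gamma)
    (XN : process p (NSII p)) (XB : process p (BHW p)) :
  [/\ NT_FPM p gamma (NSII p),
      forall t : nat,
        ('E_(prob XB)[net_utility gamma XB t]
         <= 'E_(prob XN)[net_utility gamma XN t])%E,
      ('E_(prob XB)[NSW gamma XB delta]
       < 'E_(prob XN)[NSW gamma XN delta])%E
    & (0 < \int[prob XN]_x revenue gamma XN x)%E].
Proof.
have tax0 := nonnegative_tax_NSII hp gamma.
split.
- split=> //; first exact: individually_rational_all.
  exact: truth_telling_NSII.
- move=> t; rewrite !(expected_net_utility hp _ hgamma) lee_fin.
  exact: value_BHW_le_NSII.
- have [finB cvgB] := expected_NSW hp XB hgamma hdelta.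
  have [finN cvgN] := expected_NSW hp XN hgamma hdelta.
  rewrite -(fineK finB) -(fineK finN) lte_fin.
  have /andP[d0 _] := hdelta.
  set vB := fun t => delta ^+ t * value p (BHW p) t (point_mass 0).
  set vN := fun t => delta ^+ t * value p (NSII p) t (point_mass 0).
  (* One strict term suffices: all terms are weakly ordered, so this gap survives in the limit. *)
  have gap : 0 < vN 5 - vB 5.
    by rewrite /vN /vB -mulrBr mulr_gt0 ?exprn_gt0// subr_gt0 value5_BHW_lt_NSII.
  have leBN t : vB t <= vN t.
    by rewrite ler_wpM2l ?exprn_ge0 ?(ltW d0)// value_BHW_le_NSII.
  apply: (@lt_le_trans _ _ (fine ('E_(prob XB)[NSW gamma XB delta])%E + (vN 5 - vB 5))).
    by rewrite ltrDl.
  have cvgB' : series vB n + (vN 5 - vB 5) @[n --> \oo] -->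
      fine ('E_(prob XB)[NSW gamma XB delta])%E + (vN 5 - vB 5).
    by apply: cvgD => //; exact: cvg_cst.
  rewrite -(cvg_lim _ cvgB')// -(cvg_lim _ cvgN)//.
  apply: ler_lim; [exact: cvgP cvgB'|exact: cvgP cvgN|].
  (* From n = 6 on the partial sums contain the term of index 5, which cancels the gap. *)
  exists 6 => // n /= n6; rewrite -subr_ge0 opprD addrA /series /= -sumrB.
  rewrite (big_cat_nat _ (n := 6))//= big_nat_recr//= addrAC addrK.
  by rewrite addr_ge0// sumr_ge0// => t _; rewrite subr_ge0.
- have [_ _ e4 g4] := belief_up34 hp.
  (* Index 4 is the fifth agent, after the history of four actions +1. *)
  apply: (@revenue_gt0 _ _ hp _ _ _ xpredT 4) => //.
    by apply: prodr_gt0 => s _; exact: action_mass_up.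
  exact: tax_NSII_gt0.
Qed.
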